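(* Let $d,n\ge1$ and let $f$ be a $\mathbb{C}^{n\times n}$-valued function of $d$ complex variables (see the domain convention in the context). The following statements are equivalent: (0) $f\in\mathcal{B}_d^{n\times n}$. (1) $f\in\mathcal{B}_d^{\rm rat}(\mathbb{C}^n)$. (2) There exist $\mathbb{C}^{n\times n}$-valued functions $\Phi_k(w,z)$, $k=1,\dots,d$, which are rational as functions of $z=(z_1,\dots,z_d)$ and $\overline{w}=(\overline{w}_1,\dots,\overline{w}_d)$ and which are positive kernels on $\Omega_d$, that satisfy $$\Phi_k(\lambda w,\lambda z)=\Phi_k(w,z),\qquad w,z\in\Omega_d,\ \lambda\in\mathbb{C}\setminus\{0\},\ k=1,\dots,d,$$ and $$f(z)=\sum_{k=1}^dz_k\Phi_k(w,z),\qquad w,z\in\Omega_d.$$ (2$'$) There exist rational $\mathbb{C}^{N_k\times n}$-valued functions $\phi_k$, with some $N_k\in\mathbb{N}$, $k=1,\dots,d$, with no singularities on $\Omega_d$, that satisfy $$\phi_k(\lambda z)=\phi_k(z),\qquad z\in\Omega_d,\ \lambda\in\mathbb{C}\setminus\{0\},\ k=1,\dots,d,$$ and $$f(z)=\sum_{k=1}^dz_k\phi_k(w)^*\phi_k(z),\qquad w,z\in\Omega_d.$$ (3) The double Cayley transform $\mathcal{F}=\mathcal{C}(f)$ has a finite-dimensional Givone--Roesser representation $$\mathcal{F}(\zeta)=D+C(I_m-P(\zeta)A)^{-1}P(\zeta)B,\qquad \zeta\in\mathbb{D}^d,\qquad P(\zeta)=\operatorname{Diag}[\zeta_1I_{m_1},\dots,\zeta_dI_{m_d}],$$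 with some $m,m_1,\dots,m_d\in\mathbb{Z}_+$, $m=m_1+\cdots+m_d$, where the matrix $U=\begin{bmatrix} A & B \\ C & D \end{bmatrix}\in\mathbb{C}^{(m+n)\times(m+n)}$ (with $A$ of size $m\times m$ and $D$ of size $n\times n$) is unitary and Hermitian, $U^{-1}=U^*=U$; and $1\notin\sigma(\mathcal{F}(0))$.
   Context: Notation: $\Pi=\{z\in\mathbb{C}:\operatorname{Re}z>0\}$, $\Pi^d$ is its $d$-fold product, $\mathbb{D}^d$ is the open unit polydisk, $\mathbb{T}$ the unit circle, and $\Omega_d=\bigcup_{\lambda\in\mathbb{T}}(\lambda\Pi)^d\subset\mathbb{C}^d$; $\sigma$ denotes spectrum. A matrix-valued function is rational if its entries are quotients of polynomials; rational functions agreeing on a nonempty open set are identified. Domain convention: $f$ is a function on $\Pi^d$, identified with its holomorphic (rational) continuation when there is one; conditions (0)--(2$'$), which concern functions on $\Omega_d$ or rational functions, mean that $f$ is the restriction to $\Pi^d$ of a function with the stated property. Class $\mathcal{B}_d^{n\times n}$: rational $\mathbb{C}^{n\times n}$-valued functions $f$ for which there exist $m\ge0$ and positive semidefinite Hermitian matrices $A_1,\dots,A_d\in\mathbb{C}^{(n+m)\times(n+m)}$ such that, with $A(z)=z_1A_1+\cdots+z_dA_d=\begin{bmatrix} A_{11}(z) & A_{12}(z) \\ A_{21}(z) & A_{22}(z) \end{bmatrix}$ ($A_{11}$ of size $n\times n$, $A_{22}$ of size $m\times m$), $\det A_{22}\not\equiv0$ and $$f(z)=A_{11}(z)-A_{12}(z)A_{22}(z)^{-1}A_{21}(z).\qquad(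 * )$$ Class $\mathcal{B}_d(\mathbb{C}^n)$: holomorphic functions $f:\Omega_d\to\mathbb{C}^{n\times n}$ representable on $\Omega_d$ in the form $( * )$, where $A(z)=z_1A_1+\cdots+z_dA_d$ with positive semidefinite bounded operators $A_k$ on $\mathbb{C}^n\oplus\mathcal{H}$ for some (possibly infinite-dimensional) Hilbert space $\mathcal{H}$, the block decomposition being with respect to $\mathbb{C}^n\oplus\mathcal{H}$ and $A_{22}(z)$ being invertible for $z\in\Omega_d$. $\mathcal{B}_d^{\rm rat}(\mathbb{C}^n)$ is the subclass of rational functions in $\mathcal{B}_d(\mathbb{C}^n)$. Positive kernel: a function $\Theta:\Lambda\times\Lambda\to\mathbb{C}^{n\times n}$ is a positive kernel on $\Lambda$ if $\sum_{i,j=1}^N\langle\Theta(\lambda_i,\lambda_j)u_j,u_i\rangle\ge0$ for all $N$, all $\lambda_1,\dots,\lambda_N\in\Lambda$ and all $u_1,\dots,u_N\in\mathbb{C}^n$. Double Cayley transform: $\mathcal{F}=\mathcal{C}(f)$ is $$\mathcal{F}(\zeta)=\Big(f\big(\tfrac{1+\zeta_1}{1-\zeta_1},\dots,\tfrac{1+\zeta_d}{1-\zeta_d}\big)-I_n\Big)\Big(f\big(\tfrac{1+\zeta_1}{1-\zeta_1},\dots,\tfrac{1+\zeta_d}{1-\zeta_d}\big)+I_n\Big)^{-1},\quad\zeta\in\mathbb{D}^d;$$ condition (3) includes the requirement that it is defined, i.e. that $f(z)+I_n$ is invertible for all $z\in\Pi^d$. *)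

(* Defs.v *)
From HB Require Import structures.
From mathcomp Require Import all_boot all_order all_algebra.
From mathcomp Require Import sesquilinear spectral fraction complex.
From mathcomp Require Import -(notations) mpoly.
From mathcomp Require Import all_classical all_reals all_analysis.

Set Implicit Arguments.
Unset Strict Implicit.
Unset Printing Implicit Defensive.

Import Order.TTheory GRing.Theory Num.Theory.
Import numFieldNormedType.Exports.

Local Open Scope classical_set_scope.
Local Open Scope ring_scope.
Local Open Scope sesquilinear_scope.

(* Everything is defined over an arbitrary numClosedFieldType C, to be
   instantiated with the complex numbers R[i] over R : realType.  In such a C,
   [0 <= x] says that x is real and nonnegative. *)

(* A point of C^d is a row vector 'rV[C]_d; vectors of C^n on which matrices
   act are columns 'cV[C]_n. *)

Definition polyhalfplane (C : numClosedFieldType) (d : nat) : set 'rV[C]_d :=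
  [set z | forall k, 0 < 'Re (z 0 k)].

Definition Omega (C : numClosedFieldType) (d : nat) : set 'rV[C]_d :=
  [set z | exists lam : C, `|lam| = 1 /\
           exists2 w : 'rV[C]_d, @polyhalfplane C d w & z = lam *: w].

Definition polydisk (C : numClosedFieldType) (d : nat) : set 'rV[C]_d :=
  [set z | forall k, `|z 0 k| < 1].

(* Scalar rational functions of d variables, as formal fractions: two of them
   that agree on a nonempty open set are equal. *)
Definition ratfun (C : numClosedFieldType) (d : nat) : fieldType :=
  {fraction (mpoly d C)}.

Section Rational.
Context (C : numClosedFieldType).

Definition ratvar d (k : 'I_d) : ratfun C d :=
  FracField.tofrac (mpolyX C (mnm1 k)).

Definition ratcst d (c : C) : ratfun C d :=
  FracField.tofrac (mpolyC d c).

(* r is regular at z (some fraction representing r has a denominator that does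
   not vanish at z) and its value there is c. *)
Definition ratvalue d (r : ratfun C d) (z : 'rV[C]_d) (c : C) : Prop :=
  exists p q : mpoly d C,
    [/\ r = FracField.tofrac p / FracField.tofrac q,
        meval (fun k => z 0 k) q != 0
      & c = meval (fun k => z 0 k) p / meval (fun k => z 0 k) q].

Definition mxratvalue d p q (r : 'M[ratfun C d]_(p, q)) (z : 'rV[C]_d)
    (M : 'M[C]_(p, q)) : Prop :=
  forall i j, ratvalue (r i j) z (M i j).

(* On D, g is the restriction of r; in particular r has no singularity on D. *)
Definition restriction d p q (D : set 'rV[C]_d) (r : 'M[ratfun C d]_(p, q))
    (g : 'rV[C]_d -> 'M[C]_(p, q)) : Prop :=
  forall z, D z -> mxratvalue r z (g z).

Definition rational_on d p q (D : set 'rV[C]_d)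
    (g : 'rV[C]_d -> 'M[C]_(p, q)) : Prop :=
  exists r : 'M[ratfun C d]_(p, q), restriction D r g.

(* Phi w z is on D x D a rational function of the 2d variables conj w, z. *)
Definition sesquirational_on d p q (D : set 'rV[C]_d)
    (Phi : 'rV[C]_d -> 'rV[C]_d -> 'M[C]_(p, q)) : Prop :=
  exists r : 'M[ratfun C (d + d)]_(p, q),
    forall w z, D w -> D z -> mxratvalue r (row_mx (map_mx Num.conj w) z) (Phi w z).

End Rational.

Section Classes.
Context (C : numClosedFieldType).

Definition psdmx n (A : 'M[C]_n) : Prop :=
  A \is hermsymmx /\ forall x : 'cV[C]_n, 0 <= (x ^t* *m A *m x) 0 0.

(* The linear pencil z_1 A_1 + ... + z_d A_d over the field of rational
   functions. *)
Definition mxpencil d n (A : 'I_d -> 'M[C]_n) : 'M[ratfun C d]_n :=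
  \sum_k ratvar C k *: map_mx (@ratcst C d) (A k).

(* B_d^{n x n}, a class of matrices of formal rational functions. *)
Definition Bclass d n (r : 'M[ratfun C d]_n) : Prop :=
  exists (m : nat) (A : 'I_d -> 'M[C]_(n + m)),
    let L := mxpencil A in
    [/\ forall k, psdmx (A k),
        \det (drsubmx L) != 0
      & r = ulsubmx L - ursubmx L *m invmx (drsubmx L) *m dlsubmx L].

Definition dot_sum n (H : lmodType C) (dot : {dot H for Num.conj})
    (x y : 'cV[C]_n * H) : C :=
  (y.1 ^t* *m x.1) 0 0 + dot x.2 y.2.

Definition oppencil d (V : lmodType C) (A : 'I_d -> {linear V -> V})
    (z : 'rV[C]_d) (x : V) : V :=
  \sum_k z 0 k *: A k x.

Definition op11 (V W : lmodType C) (T : V * W -> V * W) (x : V) : V :=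
  (T (x, 0)).1.
Definition op12 (V W : lmodType C) (T : V * W -> V * W) (y : W) : V :=
  (T (0, y)).1.
Definition op21 (V W : lmodType C) (T : V * W -> V * W) (x : V) : W :=
  (T (x, 0)).2.
Definition op22 (V W : lmodType C) (T : V * W -> V * W) (y : W) : W :=
  (T (0, y)).2.

Definition bounded_inverse (H : normedModType C) (T S : H -> H) : Prop :=
  [/\ continuous S, cancel T S & cancel S T].

(* The Hilbert space H is a complete normed module whose norm is given by the
   inner product [dot], linear in its first argument.  The product topology on
   C^n x H is that of the Hilbert sum, so a linear operator on the sum is
   bounded iff it is continuous. *)
Definition has_Hilbert_representation d n
    (g : 'rV[C]_d -> 'M[C]_n) : Prop :=
  exists (H : completeNormedModType C) (dot : {dot H for Num.conj})
         (A : 'I_d -> {linear ('cV[C]_n * H)%type -> ('cV[C]_n * H)%type}),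
    [/\ forall x : H, `|x| ^+ 2 = dot x x,
        forall k, continuous (A k),
        forall k x, 0 <= dot_sum dot (A k x) x
      & forall z, @Omega C d z ->
          let L := oppencil A z in
          exists2 S : H -> H, bounded_inverse (op22 L) S &
            forall u : 'cV[C]_n, g z *m u = op11 L u - op12 L (S (op21 L u))].

Definition holomorphic_on d n (D : set 'rV[C]_d)
    (g : 'rV[C]_d -> 'M[C]_n) : Prop :=
  forall z, D z -> differentiable g z.

(* B_d(C^n) *)
Definition BHclass d n (g : 'rV[C]_d -> 'M[C]_n) : Prop :=
  holomorphic_on (@Omega C d) g /\ has_Hilbert_representation g.

Definition BHratclass d n (g : 'rV[C]_d -> 'M[C]_n) : Prop :=
  BHclass g /\ rational_on (@Omega C d) g.

Definition positive_kernel (T : Type) n (D : set T)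
    (Theta : T -> T -> 'M[C]_n) : Prop :=
  forall (N : nat) (l : 'I_N -> T) (u : 'I_N -> 'cV[C]_n),
    (forall i, D (l i)) ->
    0 <= \sum_i \sum_j ((u i) ^t* *m (Theta (l i) (l j) *m u j)) 0 0.

Definition cayley_arg d (zeta : 'rV[C]_d) : 'rV[C]_d :=
  \row_k ((1 + zeta 0 k) / (1 - zeta 0 k)).

Definition cayley_defined d n (f : 'rV[C]_d -> 'M[C]_n) : Prop :=
  forall z, @polyhalfplane C d z -> f z + 1%:M \in unitmx.

Definition double_cayley d n (f : 'rV[C]_d -> 'M[C]_n) (zeta : 'rV[C]_d) :
    'M[C]_n :=
  (f (cayley_arg zeta) - 1%:M) *m invmx (f (cayley_arg zeta) + 1%:M).

Definition spectrum n (M : 'M[C]_n) : set C :=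
  [set a | a%:M - M \notin unitmx].

(* Invertibility of 1 - P A on the polydisk is part of the representation
   formula making sense (it is automatic when U is unitary). *)
Definition GR_representation d n (mk : 'I_d -> nat)
    (A : 'M[C]_(\sum_k mk k)) (B : 'M[C]_(\sum_k mk k, n))
    (E : 'M[C]_(n, \sum_k mk k)) (D : 'M[C]_n)
    (F : 'rV[C]_d -> 'M[C]_n) : Prop :=
  forall zeta, @polydisk C d zeta ->
    let P : 'M[C]_(\sum_k mk k) := \mxdiag_k (zeta 0 k)%:M in
    1%:M - P *m A \in unitmx /\
    F zeta = D + E *m invmx (1%:M - P *m A) *m P *m B.

End Classes.

(* Main.v *)
(* All five conditions are equivalent to the existence of a Schur complement
   representation of f on Pi^d by a finite-dimensional nonnegative pencil A
   whose compression A_22 has no common kernel, which makes A_22 invertible on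
   Omega_d (Schur_data).

   With V(z) = [1; -A_22(z)^-1 A_21(z)] one has A(z) V(z) = [f(z); 0], hence
   f(z) = sum_k z_k V(w)^* A_k V(z): this is (2), and (2') after factoring A_k.
   Conversely, suppose f(z) = phi(w)^* Z phi(z), where Z acts as z_k on the k-th
   block of a finite-dimensional space.  Compressing Z to the affine span of the
   values of phi gives back a Schur complement.  Condition (3) is of that type:
   a Hermitian unitary colligation is a reflection, and its eigenspaces for 1
   and -1 are orthogonal.

   From (1) or (2) one only gets positive kernels Phi_k with
   f(z) = sum_k z_k Phi_k(w, z), and the rationality of f must force finite rank.
   On a line x + t y with x, y positive, the kernel N = sum_k y_k Phi_k satisfies
   (t - s) N(s, t) = f(x + t y) - f(x + s y); so if q is a denominator of f, then
   q N(s, .) is a polynomial of bounded degree, and q Phi_k(w, .) is obtained by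
   Lagrange interpolation from finitely many nodes, with coefficients depending
   neither on k nor on w.  Doing this in d independent positive directions
   expresses all the Phi_k through their values on a finite grid. *)
Require Import Defs.
From HB Require Import structures.
From mathcomp Require Import all_boot all_order all_algebra.
From mathcomp Require Import sesquilinear spectral fraction complex.
From mathcomp Require Import -(notations) mpoly.
From mathcomp Require Import all_classical all_reals all_analysis.
From mathcomp Require Import ring.

Set Implicit Arguments.
Unset Strict Implicit.
Unset Printing Implicit Defensive.

Import Order.TTheory GRing.Theory Num.Theory.
Import numFieldNormedType.Exports.

Local Open Scope classical_set_scope.
Local Open Scope ring_scope.
Local Open Scope sesquilinear_scope.

(** * Positive semidefinite matrices and Schur complements *)

Section PositiveSemidefinite.
Context {C : numClosedFieldType}.

Lemma ctmxM m n p (A : 'M[C]_(m, n)) (B : 'M[C]_(n, p)) :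
  (A *m B) ^t* = B ^t* *m A ^t*.
Proof. by rewrite trmx_mul map_mxM. Qed.

Lemma hermsymmxP n (A : 'M[C]_n) : reflect (A ^t* = A) (A \is hermsymmx).
Proof.
apply: (iffP (is_hermitianmxP _ _ _)); rewrite expr0 scale1r => h; exact: esym.
Qed.

Lemma cv_sqnorm n (x : 'cV[C]_n) : (x ^t* *m x) 0 0 = \sum_i `|x i 0| ^+ 2.
Proof. by rewrite mxE; apply: eq_bigr => i _; rewrite !mxE normCKC. Qed.

Lemma cv_sqnorm_ge0 n (x : 'cV[C]_n) : 0 <= (x ^t* *m x) 0 0.
Proof. by rewrite cv_sqnorm sumr_ge0 // => i _; rewrite exprn_ge0. Qed.

Lemma cv_sqnorm_eq0 n (x : 'cV[C]_n) : (x ^t* *m x) 0 0 = 0 -> x = 0.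
Proof.
move=> /eqP; rewrite cv_sqnorm psumr_eq0 => [/allP x0|i _]; last exact: exprn_ge0.
apply/colP => i; rewrite mxE; apply/eqP.
by have := x0 i (mem_index_enum _); rewrite expf_eq0 normr_eq0.
Qed.

Lemma psdmx_gram m n (S : 'M[C]_(m, n)) : psdmx (S ^t* *m S).
Proof.
split=> [|x]; first by apply/hermsymmxP; rewrite ctmxM trmxCK.
by rewrite -mulmxA -mulmxA mulmxA -ctmxM cv_sqnorm_ge0.
Qed.

(** By the spectral theorem [A] is [P^* D P] with [P] unitary. Testing the form on the columns of
    [P^*] gives [D >= 0], and [S] is [sqrt D P]. *)
Lemma psdmx_factor n (A : 'M[C]_n) :
  psdmx A -> exists S : 'M[C]_n, A = S ^t* *m S.
Proof.
move=> [herA posA].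
have /orthomx_spectralP := hermitian_normalmx herA.
set P := spectralmx A; set D := spectral_diag A => defA.
have uP : P \is unitarymx by exact: spectral_unitarymx.
rewrite invmx_unitary // in defA.
have PP : P *m P ^t* = 1%:M by exact/unitarymxP.
have D_ge0 i : 0 <= D 0 i.
  have := posA (P ^t* *m delta_mx i 0); rewrite ctmxM trmxCK defA !mulmxA.
  rewrite -(mulmxA _ P) PP mulmx1 -(mulmxA _ P) PP mulmx1.
  have -> : (delta_mx i 0 : 'cV[C]_n) ^t* = delta_mx 0 i.
    by apply/matrixP => a b; rewrite !mxE andbC; case: (_ && _);
      rewrite ?rmorph0 ?rmorph1.
  by rewrite -rowE -colE !mxE eqxx mulr1n.
exists (diag_mx (map_mx sqrtC D) *m P).
rewrite defA ctmxM mulmxA -(mulmxA (P ^t*)); congr (_ *m _ *m _).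
rewrite tr_diag_mx map_diag_mx mulmx_diag; congr diag_mx; apply/rowP => i.
rewrite !mxE /=; have rs : (sqrtC (D 0 i))^* = sqrtC (D 0 i).
  by rewrite conj_Creal ?ger0_real ?sqrtC_ge0.
by rewrite rs -expr2 sqrtCK.
Qed.

Lemma psdmx_congr m n (T : 'M[C]_(n, m)) (A : 'M[C]_n) :
  psdmx A -> psdmx (T ^t* *m A *m T).
Proof.
move=> /psdmx_factor [S ->].
by rewrite mulmxA -ctmxM -mulmxA; exact: psdmx_gram.
Qed.

Lemma psdmx_ker n (A : 'M[C]_n) (x : 'cV[C]_n) :
  psdmx A -> (x ^t* *m A *m x) 0 0 = 0 -> A *m x = 0.
Proof.
move=> /psdmx_factor [S ->]; rewrite mulmxA -ctmxM -mulmxA => /cv_sqnorm_eq0 Sx.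
by rewrite -mulmxA Sx mulmx0.
Qed.

End PositiveSemidefinite.

(** * Linear pencils and their Schur complements *)

Section Schur.
Context {C : numClosedFieldType}.

Definition pencil d n (A : 'I_d -> 'M[C]_n) (z : 'rV[C]_d) : 'M[C]_n :=
  \sum_k z 0 k *: A k.

Definition schur (F : comUnitRingType) n m (L : 'M[F]_(n + m)) : 'M[F]_n :=
  ulsubmx L - ursubmx L *m invmx (drsubmx L) *m dlsubmx L.

(** This is the column [V] of the overview: the identity above the solution of the lower block
    equation. *)
Definition schur_sol (F : comUnitRingType) n m (L : 'M[F]_(n + m)) :
    'M[F]_(n + m, n) :=
  col_mx 1%:M (- (invmx (drsubmx L) *m dlsubmx L)).

Lemma mul_schur_sol (F : comUnitRingType) n m (L : 'M[F]_(n + m)) :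
  drsubmx L \in unitmx -> L *m schur_sol L = col_mx (schur L) 0.
Proof.
move=> uL; rewrite -{1}(submxK L) mul_block_col !mulmx1 !mulmxN !mulmxA.
by rewrite mulmxV // mul1mx subrr.
Qed.

Lemma schur_uniq (F : comUnitRingType) n m (L : 'M[F]_(n + m)) X f :
  drsubmx L \in unitmx -> L *m col_mx 1%:M X = col_mx f 0 -> f = schur L.
Proof.
move=> uL; rewrite -{1}(submxK L) mul_block_col !mulmx1 => /eq_col_mx[<- h].
rewrite /schur -mulmxA -mulmxN; congr (_ + _ *m _).
by rewrite -[LHS](mulKmx uL) -mulmxN; congr (_ *m _); apply/eqP;
  rewrite -addr_eq0 addrC h.
Qed.

Lemma unitmx_ker0 n (A : 'M[C]_n) :
  (forall x : 'cV[C]_n, A *m x = 0 -> x = 0) -> A \in unitmx.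
Proof.
move=> A0; rewrite -unitmx_tr -row_free_unit; apply: inj_row_free => v vA.
by apply: trmx_inj; rewrite trmx0; apply: A0; rewrite -[A]trmxK -trmx_mul vA trmx0.
Qed.

Lemma polyhalfplane_Omega d (z : 'rV[C]_d) : polyhalfplane z -> Omega z.
Proof.
by move=> zP; exists 1; rewrite normr1; split=> //; exists z; rewrite ?scale1r.
Qed.

Lemma pencilZ d n (A : 'I_d -> 'M[C]_n) z a :
  pencil A (a *: z) = a *: pencil A z.
Proof.
by rewrite /pencil scaler_sumr; apply: eq_bigr => k _; rewrite mxE scalerA.
Qed.

(** A point of Omega is a unimodular multiple of some [w] in Pi^d. If [A(w) x = 0], then the real
    part of [<A(w) x, x>] is the sum of the [Re w_k <A_k x, x>]; the weights are positive and the
    forms nonnegative, so every [A_k x] vanishes. *)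
Lemma pencil_unitmx d n (A : 'I_d -> 'M[C]_n) (z : 'rV[C]_d) :
  (forall k, psdmx (A k)) ->
  (forall x : 'cV[C]_n, (forall k, A k *m x = 0) -> x = 0) ->
  Omega z -> pencil A z \in unitmx.
Proof.
move=> Apsd A0 [a [a1 [w wP ->]]]; apply: unitmx_ker0 => x Ax0; apply: A0.
have a0 : a != 0 by rewrite -normr_eq0 a1 oner_neq0.
pose q k := (x ^t* *m A k *m x) 0 0.
have q_ge0 k : 0 <= q k by exact: (Apsd k).2.
have : \sum_k w 0 k * q k = 0.
  have : (x ^t* *m pencil A w *m x) 0 0 = 0.
    rewrite -mulmxA (_ : pencil A w *m x = 0) ?mulmx0 ?mxE //.
    by apply/eqP; move/eqP: Ax0; rewrite pencilZ -scalemxAl scaler_eq0 (negbTE a0).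
  rewrite /pencil mulmx_sumr mulmx_suml summxE => h; rewrite -[RHS]h.
  by apply: eq_bigr => k _; rewrite -scalemxAr -scalemxAl mxE.
move=> /(congr1 (fun t => 'Re t)) /=; rewrite raddf_sum raddf0.
under eq_bigr => k _ do rewrite /= ReMr ?ger0_real //.
move=> /eqP; rewrite psumr_eq0 => [/allP h k|k _]; last first.
  by rewrite mulr_ge0 // ltW // wP.
apply: psdmx_ker => //; have := h k (mem_index_enum _).
by rewrite mulf_eq0 gt_eqF ?wP //= => /eqP.
Qed.

Lemma pencil_congr d n m (A : 'I_d -> 'M[C]_n) (T : 'M[C]_(n, m)) z :
  pencil (fun k => T ^t* *m A k *m T) z = T ^t* *m pencil A z *m T.
Proof.
rewrite /pencil mulmx_sumr mulmx_suml; apply: eq_bigr => k _.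
by rewrite -scalemxAr -scalemxAl.
Qed.

Lemma drsubmx_pencil d n m (A : 'I_d -> 'M[C]_(n + m)) z :
  drsubmx (pencil A z) = pencil (fun k => drsubmx (A k)) z.
Proof.
apply/matrixP => i j; rewrite !mxE !summxE; apply: eq_bigr => k _.
by rewrite !mxE.
Qed.

Lemma psdmx_drsubmx n m (A : 'M[C]_(n + m)) : psdmx A -> psdmx (drsubmx A).
Proof.
move=> /(psdmx_congr (col_mx 0 1%:M : 'M[C]_(n + m, m))).
rewrite -{1}(submxK A) tr_col_mx map_row_mx trmx0 map_mx0 trmx1 map_mx1.
by rewrite mul_row_block mul_row_col !mul0mx !mul1mx !add0r mulmx0 mulmx1 add0r.
Qed.

(** [P] is an arbitrary predicate, so the basis is that of a subspace of maximal rank inside [P]; a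
    vector of [P] outside it would enlarge it. *)
Lemma subspace_basis (F : fieldType) N (P : 'rV[F]_N -> Prop) :
  P 0 -> (forall a u v, P u -> P v -> P (a *: u + v)) ->
  exists m (B : 'M[F]_(m, N)), row_free B /\ forall v, P v <-> (v <= B)%MS.
Proof.
move=> P0 Plin.
pose Q r := `[< exists B : 'M[F]_N, \rank B = r /\ forall v, (v <= B)%MS -> P v >].
have Q0 : exists r, Q r.
  exists 0%N; apply/asboolP; exists 0; split=> [|v]; first exact: mxrank0.
  by rewrite submx0 => /eqP ->.
have Qub r : Q r -> (r <= N)%N by move=> /asboolP [B [<- _]]; exact: rank_leq_row.
case: (ex_maxnP Q0 Qub) => r /asboolP [B [Br BP]] rmax.
exists (\rank B), (row_base B); split=> [|v]; first exact: row_base_free.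
rewrite eq_row_base; split=> [Pv|]; last exact: BP.
apply: contraT => vB; suff: Q (\rank (B + v)%MS).
  move=> /rmax; rewrite -Br leqNgt => /negP[]; apply: rank_ltmx.
  by rewrite ltmxE addsmxSl addsmx_sub submx_refl.
apply/asboolP; exists (B + v)%MS; split=> // u /sub_addsmxP [[a b] /= ->].
rewrite addrC [b]mx11_scalar mul_scalar_mx; apply: Plin => //.
by apply: BP; exact: submxMl.
Qed.

(** By [pencil_unitmx] the second clause gives the invertibility of [A_22(z)] on all of Omega,
    however small [D] is, so a representation on [D] can be extended. *)
Definition Schur_data d n (D : set 'rV[C]_d) (f : 'rV[C]_d -> 'M[C]_n) :=
  exists m (A : 'I_d -> 'M[C]_(n + m)),
    [/\ forall k, psdmx (A k),
        forall x : 'cV[C]_m, (forall k, drsubmx (A k) *m x = 0) -> x = 0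
      & forall z, D z -> f z = schur (pencil A z)].

(* The subspace P below contains all the differences phi w - phi w0, so that phi
   takes its values in phi w0 + P, and P is orthogonal to G(z) phi(z). *)
Lemma Schur_data_of_features d n N (D : set 'rV[C]_d) (f : 'rV[C]_d -> 'M[C]_n)
    (G : 'I_d -> 'M[C]_N) (phi : 'rV[C]_d -> 'M[C]_(N, n)) w0 :
  D `<=` @Omega C d -> D w0 ->
  (forall k, psdmx (G k)) -> \sum_k G k = 1%:M ->
  (forall w z, D w -> D z -> f z = (phi w) ^t* *m pencil G z *m phi z) ->
  Schur_data D f.
Proof.
move=> DO Dw0 Gpsd G1 fE.
pose P (v : 'rV[C]_N) :=
  forall z, D z -> map_mx Num.conj v *m pencil G z *m phi z = 0.
have [|a u v Pu Pv z Dz|m [B [freeB PB]]] := @subspace_basis C N P.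
- by move=> z _; rewrite map_mx0 !mul0mx.
- by rewrite map_mxD map_mxZ !mulmxDl -!scalemxAl Pu // Pv // scaler0 addr0.
(* The columns of [L] span the directions in [P]. In the compression by [T] the first block belongs
   to the base value [phi w0], the second to [P]. *)
pose L := B^T; pose T := row_mx (phi w0) L.
have LG z : D z -> L ^t* *m pencil G z *m phi z = 0.
  move=> Dz; apply/row_matrixP => i; rewrite row0 !row_mul /L trmxK.
  rewrite -map_row; have /PB : (row i B <= B)%MS by exact: row_sub.
  exact.
have phiE z : D z -> exists X, phi z = phi w0 + L *m X.
  move=> Dz; suff /submxP [X XE] : ((phi z - phi w0)^T <= B)%MS.
    exists X^T; rewrite /L -trmx_mul -XE trmxK addrC subrK //.
  apply/row_subP => i; apply/PB => z' Dz'.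
  rewrite map_row -!row_mul [_^T]raddfB map_mxB /= !mulmxBl.
  (* Both products are rows of [f z'], because the left factor may be taken at any point of [D]. *)
  by rewrite -!fE // subrr row0.
exists m, (fun k => T ^t* *m G k *m T).
have drE M : drsubmx (T ^t* *m M *m T) = L ^t* *m M *m L.
  rewrite /T tr_row_mx map_col_mx mul_col_mx mul_col_row; exact: block_mxKdr.
have nd (x : 'cV[C]_m) :
    (forall k, drsubmx (T ^t* *m G k *m T) *m x = 0) -> x = 0.
  (* The [G k] add up to the identity, so the sum of the equations [h] is [L^* L x = 0]. *)
  move=> h; have Lx : L *m x = 0.
    apply: cv_sqnorm_eq0; rewrite -[X in X *m _]mulmx1.
    rewrite -G1 mulmx_sumr mulmx_suml summxE big1 // => k _.
    have := h k; rewrite drE -!mulmxA => hk.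
    by rewrite ctmxM -!mulmxA hk mulmx0 mxE.
  apply: trmx_inj; apply: (row_free_inj freeB).
  by rewrite trmx0 mul0mx -[B]trmxK -trmx_mul -/L Lx trmx0.
split=> // [k|z Dz]; first exact: psdmx_congr.
have [X XE] := phiE z Dz.
apply: (@schur_uniq _ _ _ _ X).
  rewrite drsubmx_pencil; apply: pencil_unitmx => // [k|]; last exact: DO.
  by apply: psdmx_drsubmx; exact: psdmx_congr.
rewrite pencil_congr -(mulmxA _ T) mul_row_col mulmx1 -XE.
rewrite /T tr_row_mx map_col_mx !mul_col_mx -fE // LG //.
Qed.

End Schur.

(** * Positive kernels *)

Section PositiveKernel.
Context {C : numClosedFieldType} (T : Type) (n : nat) (D : set T).
Context (K : T -> T -> 'M[C]_n) (Kpos : positive_kernel D K).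

Lemma positive_kernel_diag w (u : 'cV[C]_n) :
  D w -> 0 <= (u ^t* *m (K w w *m u)) 0 0.
Proof.
by move=> Dw; have := @Kpos 1%N (fun=> w) (fun=> u) (fun=> Dw); rewrite !big_ord1.
Qed.

Lemma positive_kernel_pair w z (u v : 'cV[C]_n) : D w -> D z ->
  0 <= (u ^t* *m (K w w *m u)) 0 0 + (u ^t* *m (K w z *m v)) 0 0 +
       ((v ^t* *m (K z w *m u)) 0 0 + (v ^t* *m (K z z *m v)) 0 0).
Proof.
move=> Dw Dz.
have := @Kpos 2 (fun i => if i == 0 then w else z) (fun i => if i == 0 then u else v).
by rewrite !big_ord_recl !big_ord0 /= !addr0; apply => i; case: ifP.
Qed.

(** Polarisation: the cross terms of the two-point form add up to a real number, because the whole
    form and its diagonal terms are real. The coefficients [1] and ['i] show that [a + b] and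
    ['i (a - b)] are real for opposite entries [a], [b], which are therefore conjugate. *)
Lemma positive_kernel_herm w z : D w -> D z -> (K w z) ^t* = K z w.
Proof.
move=> Dw Dz.
have key (u v : 'cV[C]_n) :
    (u ^t* *m (K w z *m v)) 0 0 + (v ^t* *m (K z w *m u)) 0 0 \is Num.real.
  have e (A a b B : C) : a + b = A + a + (b + B) - A - B by ring.
  rewrite (e ((u ^t* *m (K w w *m u)) 0 0) _ _ ((v ^t* *m (K z z *m v)) 0 0)).
  by rewrite !rpredB ?ger0_real ?positive_kernel_diag ?positive_kernel_pair.
apply/matrixP => i j; rewrite !mxE.
have entry (M : 'M[C]_n) a b a' b' :
    ((a *: delta_mx a' 0 : 'cV[C]_n) ^t* *m (M *m (b *: delta_mx b' 0 : 'cV[C]_n))) 0 0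
    = a^* * b * M a' b'.
  have -> : (a *: delta_mx a' 0 : 'cV[C]_n) ^t* = a^* *: delta_mx 0 a'.
    apply/matrixP => r s; rewrite !mxE andbC rmorphM /=.
    by congr (_ * _); case: (_ && _); rewrite ?rmorph0 ?rmorph1.
  rewrite -scalemxAl -scalemxAr -scalemxAr.
  have -> : M *m delta_mx b' 0 = col b' M by rewrite colE.
  by rewrite -rowE !mxE mulrA.
have h1 := key (1 *: delta_mx j 0) (1 *: delta_mx i 0).
have h2 := key (1 *: delta_mx j 0) ('i *: delta_mx i 0).
rewrite !entry !rmorph1 !mul1r in h1; rewrite !entry !rmorph1 !mul1r mulr1 in h2.
move: h1 h2; set a := K w z j i; set b := K z w i j.
move=> /CrealP; rewrite rmorphD /= => h1.
move=> /CrealP; rewrite rmorphD !rmorphM /= conjCK conjCi !mulNr => h2.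
have i0 : 'i != 0 :> C by exact: neq0Ci.
have h3 : b^* - a^* = a - b.
  by apply: (mulfI i0); rewrite !mulrBr -[RHS]h2 addrC.
have h4 : a^* *+ 2 = b *+ 2.
  have -> : a^* *+ 2 = a^* + b^* - (b^* - a^*) by ring.
  by rewrite h1 h3; ring.
by move/eqP: h4; rewrite -subr_eq0 -mulrnBl mulrn_eq0 /= subr_eq0 => /eqP.
Qed.

(* For s > 0, perturb the null vector by -s times X = sum_j K(w, l_j) u_j at
   the point w: the form becomes s^2 <K(w, w) X, X> - 2 s |X|^2 >= 0. *)
Lemma positive_kernel_null N (l : 'I_N -> T) (u : 'I_N -> 'cV[C]_n) :
  (forall i, D (l i)) ->
  \sum_i \sum_j ((u i) ^t* *m (K (l i) (l j) *m u j)) 0 0 = 0 ->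
  forall w, D w -> \sum_j K w (l j) *m u j = 0.
Proof.
move=> Dl null w Dw; set X := \sum_j _.
apply: cv_sqnorm_eq0; set x := (_ *m X) 0 0.
have x_ge0 : 0 <= x by exact: cv_sqnorm_ge0.
pose c := (X ^t* *m (K w w *m X)) 0 0.
have c_ge0 : 0 <= c by exact: positive_kernel_diag.
have ineq s : 0 < s -> 0 <= s * (s * c - x *+ 2).
  move=> s_gt0; have sr : s^* = s by rewrite conj_Creal // gtr0_real.
  (* Index 0 carries the additional point [w] with the vector [- s X]; the other indices are the
     original family. *)
  have := @Kpos N.+1 (fun i => oapp l w (unlift ord0 i))
    (fun i => oapp u (- s *: X) (unlift ord0 i)).
  rewrite !big_ord_recl /= unlift_none /=.
  under eq_bigr => j _ do rewrite liftK /=.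
  under [X in _ + X]eq_bigr => i _.
    rewrite big_ord_recl unlift_none liftK /=.
    under eq_bigr => j _ do rewrite liftK /=.
    over.
  rewrite big_split /= null addr0.
  have -> : (- s *: X) ^t* = - s *: X ^t*.
    by rewrite linearZ /= map_mxZ rmorphN /= sr.
  move=> /(_ _)/le_trans; apply.
    by move=> i; case: (unliftP ord0 i) => [j _|_] /=.
  rewrite le_eqVlt; apply/orP; left; apply/eqP.
  have -> : \sum_j ((- s *: X ^t*) *m (K w (l j) *m u j)) 0 0 = - s * x.
    rewrite -summxE -mulmx_sumr -scalemxAl mxE //.
  have -> : \sum_i ((u i) ^t* *m (K (l i) w *m (- s *: X))) 0 0 = - s * x.
    have -> : x = \sum_i ((u i) ^t* *m (K (l i) w *m X)) 0 0.
      rewrite -summxE; under eq_bigr => i _.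
        rewrite -(positive_kernel_herm Dw (Dl i)) mulmxA -ctmxM.
        over.
      rewrite -mulmx_suml (_ : \sum_i _ = X ^t*) //.
      apply/matrixP => a b; rewrite !mxE !summxE rmorph_sum.
      by apply: eq_bigr => i _; rewrite !mxE.
    rewrite mulr_sumr; apply: eq_bigr => i _.
    by rewrite -scalemxAr -scalemxAr mxE.
  have mxZ a (M : 'M[C]_1) i j : (a *: M) i j = a * M i j by rewrite mxE.
  by rewrite -scalemxAr -scalemxAr -scalemxAl !mxZ -/c; ring.
apply/eqP/negPn/negP => x0; have x_gt0 : 0 < x by rewrite lt_def x0.
(* At [s = x / (c + 1)] the inequality says [2 x <= x c / (c + 1)], impossible for [x > 0]. Adding
   one allows [c = 0]. *)
have c1 : 0 < c + 1 by rewrite ltr_wpDl.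
have := ineq (x / (c + 1)) (divr_gt0 x_gt0 c1).
rewrite pmulr_rge0 ?divr_gt0 // subr_ge0 -mulrA -mulr_natr ler_pM2l //.
rewrite ler_pdivlMl // => h; have : (c + 1) * 2%:R <= c + 1.
  by rewrite (le_trans h) // lerDl.
by rewrite mulr_natr mulr2n gerDl lt_geF.
Qed.

End PositiveKernel.

(** * Interpolation on lines and grids *)

Section Interpolation.
Context {C : numClosedFieldType}.

Lemma poly_bounded (p : {poly C}) (b : C) :
  exists2 B, 0 <= B & forall t, `|t| <= b -> `|p.[t]| <= B.
Proof.
elim/poly_ind: p => [|p c [B B0 pB]].
  by exists 0 => // t _; rewrite horner0 normr0.
have [b0|bN] := boolP (0 <= b); last first.
  by exists 0 => // t tb; rewrite (le_trans (normr_ge0 t) tb) in bN.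
exists (B * b + `|c|) => [|t tb]; first by rewrite addr_ge0 // mulr_ge0.
rewrite hornerMXaddC (le_trans (ler_normD _ _)) // lerD2r normrM ler_pM //.
exact: pB.
Qed.

(** Multiplying by the conjugate of [q] gives a polynomial [E] which, on the positive axis, is
    nonnegative to the right of [s] and nonpositive to the left, hence zero at [s] by continuity.
    Over an abstract closed field, continuity is made explicit by a bound [B] on the difference
    quotient [F]. *)
Lemma poly_sign_change (D q : {poly C}) (s : C) :
  0 < s -> q.[s] != 0 ->
  (forall t, 0 < t -> 0 <= (t - s) * ((q.[t])^* * D.[t])) -> D.[s] = 0.
Proof.
move=> s0 qs sgn.
pose E := map_poly Num.conj q * D.
have EE t : 0 < t -> E.[t] = (q.[t])^* * D.[t].
  move=> t0; rewrite hornerM; congr (_ * _).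
  have {1}<- : t^* = t by rewrite conj_Creal // gtr0_real.
  by rewrite horner_map.
suff : E.[s] == 0 by rewrite EE // mulf_eq0 conjC_eq0 (negbTE qs) /= => /eqP.
have : root (E - (E.[s])%:P) s by rewrite rootE hornerD hornerN hornerC subrr.
move=> /factor_theorem [F FE].
have Et t : E.[t] = E.[s] + (t - s) * F.[t].
  have := congr1 (fun p : {poly C} => p.[t]) FE.
  rewrite !hornerE => /eqP; rewrite subr_eq => /eqP ->; ring.
have [B B0 FB] := poly_bounded F (s + s).
apply/negPn/negP => Es; set e := `|E.[s]|; have e0 : 0 < e by rewrite normr_gt0.
(* The factor [s e / (e + 1)] keeps [s - h] positive, and the denominator gives [3 h B < e]. Of the
   three terms [h B], two bound [E.[s + h] - E.[s - h]] and one bounds [E.[s + h] - E.[s]]. *)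
pose h := s * (e / (e + 1)) / (B * 3%:R * s + 1).
have B3s : 0 <= B * 3%:R * s by rewrite mulr_ge0 ?(ltW s0) // mulr_ge0 ?ler0n.
have den0 : 0 < B * 3%:R * s + 1 by exact: ltr_wpDl.
have e1 : 0 < e + 1 by rewrite addr_gt0.
have h0 : 0 < h by rewrite !(divr_gt0, mulr_gt0).
have hs : h < s.
  rewrite ltr_pdivrMr // ltr_pM2l //; apply: (@lt_le_trans _ _ 1).
    by rewrite ltr_pdivrMr // mul1r ltrDl.
  by rewrite lerDr.
have hB : h * B * 3%:R < e.
  rewrite -mulrA mulrAC ltr_pdivrMr //.
  rewrite (_ : s * (e / (e + 1)) * (B * 3%:R) = (e / (e + 1)) * (B * 3%:R * s));
    last by ring.
  rewrite (@le_lt_trans _ _ (e * (B * 3%:R * s))) //; last first.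
    by rewrite ltr_pM2l // ltrDl.
  apply: ler_wpM2r => //.
  by rewrite ler_pdivrMr // mulrDr mulr1 lerDr mulr_ge0 // ltW.
have hp : 0 <= E.[s + h].
  have := sgn (s + h) (addr_gt0 s0 h0); rewrite addrC addKr -EE ?addr_gt0 //.
  by rewrite pmulr_rge0.
have hm : 0 <= - E.[s - h].
  have sh : 0 < s - h by rewrite subr_gt0.
  have := sgn (s - h) sh; rewrite addrC addKr -EE // mulNr -mulrN.
  by rewrite pmulr_rge0.
have bound t : 0 < t -> t <= s + s -> `|F.[t]| <= B.
  by move=> t0 ts; apply: FB; rewrite gtr0_norm.
have Fp : `|F.[s + h]| <= B by rewrite bound ?addr_gt0 // lerD2l ltW.
have Fm : `|F.[s - h]| <= B.
  by rewrite bound ?subr_gt0 // lerD2l (le_trans _ (ltW s0)) // oppr_le0 ltW.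
have Ep : `|E.[s + h]| <= h * B * 2%:R.
  have le1 : E.[s + h] <= E.[s + h] - E.[s - h] by rewrite lerDl.
  rewrite ger0_norm // (le_trans le1) //.
  rewrite -[leLHS]ger0_norm ?addr_ge0 //.
  have -> : E.[s + h] - E.[s - h] = h * (F.[s + h] + F.[s - h]).
    by rewrite [E.[s + h]]Et [E.[s - h]]Et; ring.
  rewrite normrM gtr0_norm // -mulrA ler_pM2l // (le_trans (ler_normD _ _)) //.
  by rewrite mulr_natr mulr2n lerD.
have : e <= h * B * 3%:R.
  have -> : h * B * 3%:R = h * B * 2%:R + h * B by ring.
  rewrite /e (_ : E.[s] = E.[s + h] - h * F.[s + h]); last first.
    by rewrite [E.[s + h]]Et; ring.
  rewrite (le_trans (ler_normB _ _)) // lerD // normrM gtr0_norm //.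
  by rewrite ler_pM2l.
by rewrite lt_geF.
Qed.

(** The shift by one makes all nodes strictly positive, so that grid points fall in Pi^d. *)
Definition node (j : nat) : C := j.+1%:R.

Lemma node_inj : injective node.
Proof. by move=> i j /eqP; rewrite eqr_nat eqSS => /eqP. Qed.

Lemma node_gt0 j : 0 < node j.
Proof. exact: ltr0Sn. Qed.

Definition lagrange_coef M (j : 'I_M) (t : C) : C :=
  (tnth (M.-lagrange node) j : {poly C}).[t].

Lemma poly_lagrange M (p : {poly C}) (t : C) : (0 < M)%N -> (size p <= M)%N ->
  p.[t] = \sum_(j < M) lagrange_coef j t * p.[node j].
Proof.
move=> M0 sp; rewrite {1}(lagrange_gen M0 node_inj sp) horner_sum.
by apply: eq_bigr => j _; rewrite hornerM hornerC mulrC.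
Qed.

Definition upd d (t : 'I_d -> C) (i : 'I_d) (x : C) : 'I_d -> C :=
  fun l => if l == i then x else t l.

(** The coordinates of [t] are replaced by nodes one at a time. The coefficients are chosen before
    [h], so that the same ones serve every kernel and every first argument; [S] confines the
    coordinates to where one-variable interpolation is available. *)
Lemma grid_interpolation d M (S : C -> Prop) (t : 'I_d -> C) :
  (0 < M)%N -> (forall j, S (node j)) -> (forall i, S (t i)) ->
  exists a : {ffun 'I_d -> 'I_M} -> C, forall h : ('I_d -> C) -> C,
    (forall i t', (forall l, S (t' l)) ->
       h t' = \sum_(j < M) lagrange_coef j (t' i) * h (upd t' i (node j))) ->
    h t = \sum_J a J * h (fun i => node (J i)).
Proof.
move=> M0 Snode St.
pose mix m (J : {ffun 'I_d -> 'I_M}) : 'I_d -> C :=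
  fun i => if (i < m)%N then node (J i) else t i.
have Smix m J i : S (mix m J i) by rewrite /mix; case: ifP.
suff step m : (m <= d)%N -> exists a : {ffun 'I_d -> 'I_M} -> C, forall h,
    (forall i t', (forall l, S (t' l)) ->
       h t' = \sum_(j < M) lagrange_coef j (t' i) * h (upd t' i (node j))) ->
    h t = \sum_J a J * h (mix m J).
  have [a aP] := step d (leqnn d); exists a => h hP; rewrite (aP h hP).
  apply: eq_bigr => J _; congr (_ * h _).
  by apply/funext => i; rewrite /mix ltn_ord.
elim: m => [_|m IHm md].
  (* With no coordinate replaced every multi-index gives [t], so the whole weight is put on an
     arbitrary one. *)
  pose J0 : {ffun 'I_d -> 'I_M} := [ffun=> Ordinal M0].
  exists (fun J => (J == J0)%:R) => h _; rewrite (bigD1 J0) //= eqxx mul1r.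
  rewrite big1 ?addr0 => [|J /negbTE ->]; last by rewrite mul0r.
  by congr h; apply/funext => i; rewrite /mix ltn0.
have [a aP] := IHm (ltnW md); pose i := Ordinal md.
pose updJ (p : {ffun 'I_d -> 'I_M} * 'I_M) : {ffun 'I_d -> 'I_M} :=
  [ffun l => if l == i then p.2 else p.1 l].
(* [updJ] forgets the old value at [i], so the coefficients are summed over its fibres. *)
exists (fun J => \sum_(p | updJ p == J) a p.1 * lagrange_coef p.2 (t i)) => h hP.
rewrite (aP h hP).
transitivity (\sum_p a p.1 * lagrange_coef p.2 (t i) * h (mix m.+1 (updJ p))).
  rewrite -(pair_bigA _ (fun J j =>
    a J * lagrange_coef j (t i) * h (mix m.+1 (updJ (J, j))))) /=.
  apply: eq_bigr => J _; rewrite (hP i) // mulr_sumr; apply: eq_bigr => j _.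
  rewrite mulrA {1}/mix ltnn; congr (_ * h _); apply/funext => l.
  rewrite /upd /mix ffunE /=; have [->|li] := eqVneq l i; first by rewrite ltnSn.
  have /negbTE lm : (l : nat) != m by [].
  by rewrite [(l < m.+1)%N]ltnS [(l <= m)%N]leq_eqVlt lm.
rewrite (partition_big updJ predT) //=; apply: eq_bigr => J _.
by rewrite mulr_suml; apply: eq_bigr => p /eqP ->.
Qed.

End Interpolation.

(** * Polynomials restricted to lines *)

Section Lines.
Context {C : numClosedFieldType}.

Definition mev d (p : mpoly d C) (z : 'rV[C]_d) : C := meval (fun k => z 0 k) p.

Lemma mpoly_ring_ind d (P : mpoly d C -> Prop) :
  (forall c, P (mpolyC d c)) -> (forall i, P (mpolyX C (mnm1 i))) ->
  (forall p q, P p -> P q -> P (p + q)) -> (forall p q, P p -> P q -> P (p * q)) ->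
  forall p, P p.
Proof.
move=> PC PX PD PM p; rewrite [p]mpolyE.
apply: (big_ind P) => [||m _]; [by rewrite -[0]mpolyC0 | exact: PD |].
rewrite -mul_mpolyC; apply: (PM) => //.
rewrite mpolyXE_id; apply: (big_ind P) => [||i _]; [|exact: PM|].
  by rewrite -mpolyC1.
elim: (m i) => [|e IHe]; first by rewrite expr0 -mpolyC1.
by rewrite exprS; exact: PM.
Qed.

(** The bound is found before the line, so that one number of nodes works for all lines. *)
Lemma line_restriction d (p : mpoly d C) :
  exists M, forall x y : 'rV[C]_d, exists2 P : {poly C},
    (size P <= M)%N & forall t, P.[t] = mev p (x + t *: y).
Proof.
elim/mpoly_ring_ind: p => [c|i|p1 p2 [M1 h1] [M2 h2]|p1 p2 [M1 h1] [M2 h2]].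
- exists 1%N => x y; exists c%:P; first by rewrite size_polyC leq_b1.
  by move=> t; rewrite hornerC /mev mevalC.
- exists 2%N => x y; exists ((x 0 i)%:P + (y 0 i) *: 'X).
    rewrite (leq_trans (size_polyD _ _)) // geq_max (leq_trans (size_polyC_leq1 _)) //.
    by rewrite (leq_trans (size_scale_leq _ _)) // size_polyX.
  by move=> t; rewrite !hornerE /mev mevalXU !mxE mulrC.
- exists (maxn M1 M2) => x y.
  have [P1 s1 e1] := h1 x y; have [P2 s2 e2] := h2 x y.
  exists (P1 + P2) => [|t]; last by rewrite hornerD e1 e2 /mev mevalD.
  by rewrite (leq_trans (size_polyD _ _)) // geq_max !leq_max s1 s2 orbT.
- exists (M1 + M2)%N => x y.
  have [P1 s1 e1] := h1 x y; have [P2 s2 e2] := h2 x y.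
  exists (P1 * P2) => [|t]; last by rewrite hornerM e1 e2 /mev mevalM.
  by rewrite (leq_trans (size_polyMleq _ _)) // (leq_trans (leq_pred _)) // leq_add.
Qed.

End Lines.

(** * The kernels along a line in a positive direction *)

Section KernelLine.
Context {C : numClosedFieldType} (d n : nat) (f : 'rV[C]_d -> 'M[C]_n).
Context (Phi : 'I_d -> 'rV[C]_d -> 'rV[C]_d -> 'M[C]_n).
Hypothesis Phi_pos : forall k, positive_kernel (@polyhalfplane C d) (Phi k).
Hypothesis fE : forall w z, polyhalfplane w -> polyhalfplane z ->
  f z = \sum_k z 0 k *: Phi k w z.

Context (x y : 'rV[C]_d).
Hypothesis x_ge0 : forall k, 0 <= x 0 k.
Hypothesis y_gt0 : forall k, 0 < y 0 k.

Let zt t := x + t *: y.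

Let ztP (t : C) : 0 < t -> polyhalfplane (zt t).
Proof.
move=> t0 k; rewrite !mxE.
have h : 0 < x 0 k + t * y 0 k by rewrite ltr_wpDl // mulr_gt0.
by move: (h); rewrite -{1}(Creal_ReP _ (gtr0_real h)).
Qed.

Section Vector.
Context (u : 'cV[C]_n) (M : nat) (q p : {poly C}).
Hypotheses (qM : (size q <= M)%N) (pM : (size p <= M)%N).
Hypothesis qp : forall t : C, 0 < t -> q.[t] * (u ^t* *m (f (zt t) *m u)) 0 0 = p.[t].

Let g t : C := (u ^t* *m (f (zt t) *m u)) 0 0.
Let kap k s t : C := (u ^t* *m (Phi k (zt s) (zt t) *m u)) 0 0.
Let N s t := \sum_k y 0 k * kap k s t.

Let gE (s t : C) : 0 < s -> 0 < t -> g t = \sum_k zt t 0 k * kap k s t.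
Proof.
move=> s0 t0; rewrite /g (fE (ztP s0) (ztP t0)) mulmx_suml mulmx_sumr summxE.
by apply: eq_bigr => k _; rewrite -scalemxAl -scalemxAr mxE.
Qed.

Let kapC k (s t : C) : 0 < s -> 0 < t -> (kap k s t)^* = kap k t s.
Proof.
move=> s0 t0; rewrite /kap -(positive_kernel_herm (Phi_pos k) (ztP s0) (ztP t0)).
have -> (a : 'M[C]_1) : (a 0 0)^* = (a ^t*) 0 0 by rewrite !mxE.
by rewrite !ctmxM trmxCK mulmxA.
Qed.

Let kap_ge0 k (s : C) : 0 < s -> 0 <= kap k s s.
Proof. by move=> s0; apply: positive_kernel_diag (Phi_pos k) _ _ _; exact: ztP. Qed.

Let ztge0 k (t : C) : 0 < t -> 0 < zt t 0 k.
Proof. by move=> t0; rewrite !mxE ltr_wpDl // mulr_gt0. Qed.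

Let ztC k (t : C) : 0 < t -> (zt t 0 k)^* = zt t 0 k.
Proof. by move=> t0; rewrite conj_Creal // gtr0_real // ztge0. Qed.

Let gC (t : C) : 0 < t -> (g t)^* = g t.
Proof.
move=> t0; rewrite (gE t0 t0) conj_Creal // ger0_real // sumr_ge0 // => k _.
by rewrite mulr_ge0 ?kap_ge0 // ltW // ztge0.
Qed.

Let sum_zt s a b : \sum_k zt s 0 k * kap k a b =
  \sum_k x 0 k * kap k a b + s * N a b.
Proof.
rewrite /N mulr_sumr -big_split /=; apply: eq_bigr => k _.
by rewrite !mxE mulrDl mulrA.
Qed.

(** Expand [g t] with first argument [s], and the real number [g s] as the conjugate of its
    expansion with first argument [t]. Both then involve [kap k s t], and the parts along [x]
    cancel. *)
Let NE (s t : C) : 0 < s -> 0 < t -> (t - s) * N s t = g t - g s.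
Proof.
move=> s0 t0; rewrite (gE s0 t0) -(gC s0) (gE t0 s0) rmorph_sum /=.
under [X in _ = _ - X]eq_bigr => k _ do rewrite rmorphM /= ztC // kapC //.
by rewrite !sum_zt; ring.
Qed.

(* The linear function t |-> sum_k zt t 0 k * kap k s s dominates g, with
   equality at t = s. *)
Let support (s t : C) : 0 < s -> 0 < t -> 0 <= (t - s) * (N s s - N s t).
Proof.
move=> s0 t0.
(* Each bracket is the form of [Phi k] on the vectors [u], [- u] at the points [zt t], [zt s]. *)
have : 0 <= \sum_k zt t 0 k * (kap k t t - kap k t s - kap k s t + kap k s s).
  apply: sumr_ge0 => k _; apply: mulr_ge0; first by rewrite ltW // ztge0.
  have := positive_kernel_pair (Phi_pos k) u (- u) (ztP t0) (ztP s0).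
  rewrite [(- u)^T]raddfN map_mxN /= !mulmxN !mulNmx.
  have mxN (a : 'M[C]_1) : (- a) 0 0 = - (a 0 0) by rewrite mxE.
  rewrite !mxN opprK -/(kap k t t) -/(kap k t s) -/(kap k s t) -/(kap k s s).
  by congr (_ <= _); ring.
under eq_bigr => k _ do rewrite !mulrDr !mulrN.
rewrite !big_split /= !sumrN -(gE t0 t0) -(gE s0 t0).
have -> : \sum_k zt t 0 k * kap k t s = g t.
  rewrite -(gC t0) (gE s0 t0) rmorph_sum /=; apply: eq_bigr => k _.
  by rewrite rmorphM /= ztC // kapC.
have -> : \sum_k zt t 0 k * kap k s s = g s + (t - s) * N s s.
  by rewrite (gE s0 s0) !sum_zt; ring.
rewrite mulrBr NE // => h; apply: le_trans h _.
by rewrite le_eqVlt; apply/orP; left; apply/eqP; ring.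
Qed.

(** For [t != s], [NE] makes [q N(s, .)] the quotient of [p - g(s) q] by [t - s], a polynomial
    because [s] is a root. [NE] says nothing about [t = s]; there the inequality [support] and
    [poly_sign_change] identify [N s s]. *)
Let line_poly (s : C) : 0 < s -> q.[s] != 0 ->
  exists2 Q : {poly C}, (size Q <= M)%N & forall t, 0 < t -> q.[t] * N s t = Q.[t].
Proof.
move=> s0 qs.
have : root (p - g s *: q) s.
  by rewrite rootE !hornerE -qp // -/(g s) mulrC subrr.
move=> /factor_theorem [Q QE].
have Qt t : 0 < t -> t != s -> q.[t] * N s t = Q.[t].
  move=> t0 ts; have ts0 : t - s != 0 by rewrite subr_eq0.
  apply: (mulfI ts0); rewrite mulrCA NE //.
  have := congr1 (fun r : {poly C} => r.[t]) QE; rewrite !hornerE -qp // -/(g t).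
  by move=> h; rewrite [RHS]mulrC -h; ring.
exists Q.
  have [->|Q0] := eqVneq Q 0; first by rewrite size_poly0.
  have := congr1 (fun r : {poly C} => size r) QE.
  rewrite /= size_Mmonic ?monicXsubC // size_XsubC addn2 /= => h.
  rewrite (leq_trans (leqnSn _)) // -h (leq_trans (size_polyD _ _)) //.
  by rewrite size_polyN geq_max pM (leq_trans (size_scale_leq _ _)).
move=> t t0; have [->|ts] := eqVneq t s; last exact: Qt.
have : (N s s *: q - Q).[s] = 0.
  apply: (@poly_sign_change _ _ q) => // r r0.
  have [->|rs] := eqVneq r s; first by rewrite subrr mul0r.
  have -> : (r - s) * ((q.[r])^* * (N s s *: q - Q).[r]) =
      `|q.[r]| ^+ 2 * ((r - s) * (N s s - N s r)).
    by rewrite hornerD hornerN hornerZ -Qt // normCKC; ring.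
  by apply: mulr_ge0; [exact: exprn_ge0 | exact: support].
by rewrite !hornerE mulrC => /eqP; rewrite subr_eq0 => /eqP.
Qed.

(** The weights [b] express the interpolation error at [tau], so they annihilate the rows of [N] and
    its quadratic form vanishes at [b]. That form is the sum, with positive weights [y_k], of the
    nonnegative forms of the [Phi k]; hence each of these vanishes too, and [positive_kernel_null]
    turns this into a linear relation valid for every [w]. *)
Lemma kernel_line_vector (tau : C) k w : (0 < M)%N -> 0 < tau -> polyhalfplane w ->
  q.[tau] *: (Phi k w (zt tau) *m u) =
  \sum_(j < M) (lagrange_coef j tau * q.[node j]) *: (Phi k w (zt (node j)) *m u).
Proof.
move=> M0 tau0 wP.
pose s (i : 'I_M.+1) : C := oapp (fun j : 'I_M => node j) tau (unlift ord0 i).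
pose b (i : 'I_M.+1) : C :=
  oapp (fun j : 'I_M => - (lagrange_coef j tau * q.[node j])) q.[tau] (unlift ord0 i).
have [sE0 bE0] : s ord0 = tau /\ b ord0 = q.[tau] by rewrite /s /b unlift_none.
have sE j : s (lift ord0 j) = node j by rewrite /s liftK.
have bE j : b (lift ord0 j) = - (lagrange_coef j tau * q.[node j]).
  by rewrite /b liftK.
have s0 i : 0 < s i by rewrite /s; case: unliftP => [j _|_] //=; exact: node_gt0.
have bq i : q.[s i] = 0 -> b i = 0.
  by rewrite /s /b; case: unliftP => [j _|_] //= ->; rewrite mulr0 oppr0.
have rowN i : q.[s i] != 0 -> \sum_j b j * N (s i) (s j) = 0.
  move=> qs; have [Q QM QE] := line_poly (s0 i) qs.
  rewrite big_ord_recl sE0 bE0 QE // (poly_lagrange _ M0 QM) -big_split.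
  rewrite big1 //= => j _.
  by rewrite sE bE -QE ?node_gt0 // mulNr -mulrA addrN.
have total : \sum_k y 0 k * (\sum_i \sum_j (b i)^* * b j * kap k (s i) (s j)) = 0.
  transitivity (\sum_i (b i)^* * \sum_j b j * N (s i) (s j)).
    under eq_bigr => l _ do rewrite mulr_sumr.
    rewrite exchange_big /=; apply: eq_bigr => i _.
    under eq_bigr => l _ do rewrite mulr_sumr.
    rewrite exchange_big /= mulr_sumr; apply: eq_bigr => j _.
    rewrite /N !mulr_sumr; apply: eq_bigr => l _; ring.
  rewrite big1 // => i _; have [/bq ->|/rowN ->] := eqVneq q.[s i] 0.
    by rewrite rmorph0 mul0r.
  by rewrite mulr0.
have formE l i j : ((b i *: u) ^t* *m (Phi l (zt (s i)) (zt (s j)) *m (b j *: u))) 0 0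
    = (b i)^* * b j * kap l (s i) (s j).
  have mxZ a (A : 'M[C]_1) : (a *: A) 0 0 = a * A 0 0 by rewrite mxE.
  rewrite [(_ *: u)^T]linearZ /= map_mxZ -scalemxAl -scalemxAr -scalemxAr !mxZ.
  by rewrite mulrA.
have form_ge0 l : 0 <= \sum_i \sum_j (b i)^* * b j * kap l (s i) (s j).
  under eq_bigr => i _ do under eq_bigr => j _ do rewrite -formE.
  by apply: Phi_pos => i; exact: ztP.
have /eqP := total; rewrite psumr_eq0 => [/allP h|l _]; last first.
  by rewrite mulr_ge0 // ltW.
have := h k (mem_index_enum _); rewrite mulf_eq0 gt_eqF //= => /eqP null.
have nullE : \sum_i \sum_j ((b i *: u) ^t* *m
    (Phi k (zt (s i)) (zt (s j)) *m (b j *: u))) 0 0 = 0.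
  rewrite -[RHS]null; apply: eq_bigr => i _; apply: eq_bigr => j _.
  exact: formE.
have := positive_kernel_null (Phi_pos k) (fun i => ztP (s0 i)) nullE wP.
rewrite big_ord_recl sE0 bE0 => /eqP; rewrite addr_eq0 => /eqP.
rewrite -scalemxAr => ->; rewrite -sumrN; apply: eq_bigr => j _.
by rewrite sE bE -scalemxAr scaleNr opprK.
Qed.

End Vector.

Lemma kernel_line M (q : {poly C}) (p : 'M[{poly C}]_n) (tau : C) k w :
  (0 < M)%N -> (size q <= M)%N -> (forall i j, (size (p i j) <= M)%N) ->
  (forall t : C, 0 < t -> forall i j, q.[t] * f (x + t *: y) i j = (p i j).[t]) ->
  0 < tau -> polyhalfplane w ->
  q.[tau] *: Phi k w (x + tau *: y) =
  \sum_(j < M) (lagrange_coef j tau * q.[node j]) *: Phi k w (x + node j *: y).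
Proof.
move=> M0 qM pM qp tau0 wP.
suff key (u : 'cV[C]_n) : q.[tau] *: Phi k w (x + tau *: y) *m u =
  (\sum_(j < M) (lagrange_coef j tau * q.[node j]) *: Phi k w (x + node j *: y)) *m u.
  apply/matrixP => i j; have := key (delta_mx j 0 : 'cV[C]_n).
  by rewrite -!colE => /colP/(_ i); rewrite !mxE.
rewrite -scalemxAl mulmx_suml; under eq_bigr => j _ do rewrite -scalemxAl.
(* This is the numerator over [q] of the quadratic form of [f] at [u] along the line. *)
pose pu : {poly C} := \sum_i \sum_j ((u i 0)^* * u j 0) *: p i j.
apply: (@kernel_line_vector u M q pu) => // [|t t0].
  rewrite (leq_trans (size_sum _ _ _)) //; apply/bigmax_leqP => i _.
  rewrite (leq_trans (size_sum _ _ _)) //; apply/bigmax_leqP => j _.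
  exact: leq_trans (size_scale_leq _ _) (pM i j).
rewrite /pu horner_sum mxE mulr_sumr; apply: eq_bigr => i _.
rewrite horner_sum !mxE !mulr_sumr; apply: eq_bigr => j _.
by rewrite hornerZ -qp //; ring.
Qed.

End KernelLine.

(** * From kernels to Schur complements *)

Section RationalSchur.
Context {C : numClosedFieldType}.

(** The Schur complement multiplied by [det A_22]; the adjugate makes it meaningful over a
    polynomial ring. *)
Definition schur_num (R : comNzRingType) n m (L : 'M[R]_(n + m)) : 'M[R]_n :=
  \det (drsubmx L) *: ulsubmx L - ursubmx L *m \adj (drsubmx L) *m dlsubmx L.

Lemma invmx_adj (F : fieldType) n (A : 'M[F]_n) :
  \det A != 0 -> invmx A = (\det A)^-1 *: \adj A.
Proof. by move=> dA; rewrite /invmx unitmxE unitfE dA. Qed.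

Lemma schur_map (R : comNzRingType) (F : fieldType) (h : {rmorphism R -> F})
    n m (L : 'M[R]_(n + m)) :
  h (\det (drsubmx L)) != 0 ->
  schur (map_mx h L) = (h (\det (drsubmx L)))^-1 *: map_mx h (schur_num L).
Proof.
move=> hd; have dE : \det (drsubmx (map_mx h L)) = h (\det (drsubmx L)).
  by rewrite -map_drsubmx det_map_mx.
rewrite /schur /schur_num invmx_adj ?dE // map_mxB map_mxZ !map_mxM /= scalerBr.
rewrite scalerA mulVf // scale1r map_mx_adj.
by rewrite map_ulsubmx map_ursubmx map_dlsubmx map_drsubmx -scalemxAr -scalemxAl.
Qed.

(** The renaming [iota] places the pencil in either half of the [d + d] variables of a
    sesquirational kernel. *)
Definition mpencil d e n (iota : 'I_d -> 'I_e) (A : 'I_d -> 'M[C]_n) :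
    'M[mpoly e C]_n :=
  \sum_k mpolyX C (mnm1 (iota k)) *: map_mx (@mpolyC e C) (A k).

Lemma mev_mpencil d e n (iota : 'I_d -> 'I_e) (A : 'I_d -> 'M[C]_n)
    (x : 'rV[C]_e) :
  map_mx (meval (fun k => x 0 k)) (mpencil iota A) = pencil A (\row_k x 0 (iota k)).
Proof.
apply/matrixP => i j; rewrite !mxE !summxE rmorph_sum.
apply: eq_bigr => k _.
by rewrite !mxE rmorphM /= mevalXU mevalC.
Qed.

Lemma mxpencilE d n (A : 'I_d -> 'M[C]_n) :
  mxpencil A = map_mx (@FracField.tofrac (mpoly d C)) (mpencil id A).
Proof.
apply/matrixP => i j; rewrite !mxE !summxE rmorph_sum; apply: eq_bigr => k _.
by rewrite !mxE rmorphM.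
Qed.

End RationalSchur.

(** * Sums over blocks and Gram factorisations *)

Section FeatureSums.
Context {C : numClosedFieldType}.

Definition block_proj d (N : 'I_d -> nat) (k : 'I_d) : 'M[C]_(\sum_k N k) :=
  diag_mx (\mxrow_j const_mx (j == k)%:R).

Lemma block_projE d (N : 'I_d -> nat) (k : 'I_d) :
  block_proj N k = \mxdiag_j ((j == k)%:R%:M : 'M[C]_(N j)).
Proof.
by rewrite /block_proj diag_mxrow; apply: eq_mxdiag => j; rewrite diag_const_mx.
Qed.

Lemma mul_block_proj d (N : 'I_d -> nat) (k : 'I_d) p q
    (a : forall j, 'M[C]_(p, N j)) (b : forall j, 'M[C]_(N j, q)) :
  (\mxrow_j a j) *m block_proj N k *m (\mxcol_j b j) = a k *m b k.
Proof.
rewrite block_projE mul_mxrow_mxdiag mul_mxrow_mxcol (bigD1 k) //= eqxx mulmx1.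
by rewrite big1 ?addr0 // => j /negbTE ->; rewrite -scalemx1 scale0r mulmx0 mul0mx.
Qed.

Lemma sum_block_proj d (N : 'I_d -> nat) : \sum_k block_proj N k = 1%:M.
Proof.
apply/matrixP => i j; rewrite summxE.
rewrite (eq_bigr (fun k => (tagnat.sig1 i == k)%:R *+ (i == j))); last first.
  by move=> k _; rewrite !mxE.
rewrite (bigD1 (tagnat.sig1 i)) //= eqxx [X in _ + X]big1 => [|k].
  by rewrite addr0 mxE.
by rewrite eq_sym => /negbTE ->; rewrite mul0rn.
Qed.

Lemma psdmx_block_proj d (N : 'I_d -> nat) k : psdmx (block_proj N k).
Proof.
split.
  apply/hermsymmxP; rewrite tr_diag_mx map_diag_mx; congr diag_mx.
  by apply/rowP => i; rewrite !mxE rmorph_nat.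
move=> x; rewrite -[x]submxcolK tr_mxcol.
have -> : map_mx Num.conj (\mxrow_i (submxcol x i)^T) = \mxrow_i (submxcol x i)^t*.
  by apply/matrixP => i j; rewrite !mxE.
by rewrite mul_block_proj cv_sqnorm_ge0.
Qed.

(** Stacking the [phi k] into one column turns the sum into a single product, whose coefficients are
    the block projections: nonnegative matrices adding up to the identity. *)
Lemma Schur_data_of_sums d n (N : 'I_d -> nat)
    (phi : forall k, 'rV[C]_d -> 'M[C]_(N k, n)) (D : set 'rV[C]_d) f w0 :
  D `<=` @Omega C d -> D w0 ->
  (forall w z, D w -> D z -> f z = \sum_k z 0 k *: ((phi k w) ^t* *m phi k z)) ->
  Schur_data D f.
Proof.
move=> DO Dw0 fE.
apply: (@Schur_data_of_features _ _ _ _ D f (block_proj N)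
  (fun z => \mxcol_k phi k z) w0) => //.
- exact: psdmx_block_proj.
- exact: sum_block_proj.
move=> w z Dw Dz; rewrite (fE w z) // /pencil mulmx_sumr mulmx_suml.
apply: eq_bigr => k _; rewrite -scalemxAr -scalemxAl tr_mxcol.
have -> : map_mx Num.conj (\mxrow_i (phi i w)^T) = \mxrow_i (phi i w)^t*.
  by apply/matrixP => i j; rewrite !mxE.
by rewrite mul_block_proj.
Qed.

(** Positivity of the kernel at finitely many points is positivity of one block matrix; the [S a]
    are the column blocks of its factor. *)
Lemma positive_kernel_factor (T : Type) n (D : set T) (K : T -> T -> 'M[C]_n)
    N (Z : 'I_N -> T) :
  positive_kernel D K -> (forall a, D (Z a)) ->
  exists S : 'I_N -> 'M[C]_(\sum_(a < N) n, n),
    forall a b, K (Z a) (Z b) = (S a) ^t* *m S b.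
Proof.
move=> Kpos DZ; pose G : 'M[C]_(\sum_(a < N) n) := \mxblock_(a, b) K (Z a) (Z b).
have [|S GS] := @psdmx_factor _ _ G.
  split=> [|x].
    apply/hermsymmxP; rewrite /G tr_mxblock; apply/matrixP => i j.
    rewrite !mxE -(positive_kernel_herm Kpos (DZ (tagnat.sig1 j)) (DZ (tagnat.sig1 i))).
    by rewrite !mxE.
  rewrite -[x]submxcolK tr_mxcol.
  have -> : map_mx Num.conj (\mxrow_i (submxcol x i)^T) = \mxrow_i (submxcol x i)^t*.
    by apply/matrixP => i j; rewrite !mxE.
  rewrite mul_mxrow_mxblock mul_mxrow_mxcol summxE.
  under eq_bigr => j _ do rewrite mulmx_suml summxE.
  rewrite exchange_big /=.
  under eq_bigr => i _ do under eq_bigr => j _ do rewrite -mulmxA.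
  exact: Kpos.
exists (fun a => submxrow S a) => a b.
have <- : submxblock G a b = K (Z a) (Z b) by rewrite mxblockK.
rewrite GS -{1 2}[S]submxrowK tr_mxrow.
have -> : map_mx Num.conj (\mxcol_j (submxrow S j)^T) = \mxcol_j (submxrow S j)^t*.
  by apply/matrixP => i j; rewrite !mxE.
by rewrite mul_mxcol_mxrow mxblockK.
Qed.

End FeatureSums.

(** * Local denominators and polynomial identities on a positive cone *)

Section Regular.
Context {C : numClosedFieldType} (d : nat).

(* The denominator q may vanish at other points of Pi^d. *)
Definition regular_at (z0 : 'rV[C]_d) (h : 'rV[C]_d -> C) :=
  exists p q : mpoly d C, mev q z0 != 0 /\
    forall z, polyhalfplane z -> mev q z * h z = mev p z.

Lemma regular_common_denominator (I : finType) z0 (h : I -> 'rV[C]_d -> C) :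
  (forall i, regular_at z0 (h i)) ->
  exists (q : mpoly d C) (p : I -> mpoly d C), mev q z0 != 0 /\
    forall i z, polyhalfplane z -> mev q z * h i z = mev (p i) z.
Proof.
move=> /fin_all_exists [p /fin_all_exists [q pq]].
exists (\prod_i q i), (fun i => p i * \prod_(j | j != i) q j); split.
  rewrite /mev rmorph_prod prodf_seq_neq0; apply/allP => i _ /=.
  exact: (pq i).1.
move=> i z zP; rewrite (bigD1 i) //= /mev !mevalM.
by have := (pq i).2 z zP; rewrite /mev => <-; ring.
Qed.

Lemma regular_at_sum (I : finType) z0 (a : I -> 'rV[C]_d -> C)
    (h : I -> 'rV[C]_d -> C) :
  (forall i, exists p : mpoly d C, forall z, a i z = mev p z) ->
  (forall i, regular_at z0 (h i)) -> regular_at z0 (fun z => \sum_i a i z * h i z).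
Proof.
move=> /fin_all_exists [b bE] /regular_common_denominator [q [p [q0 pq]]].
exists (\sum_i b i * p i), q; split=> // z zP.
rewrite mulr_sumr /mev rmorph_sum; apply: eq_bigr => i _.
have := pq i z zP; have := bE i z; rewrite /= mevalM /mev => -> <-; ring.
Qed.

(** A linear change of coordinates in which every coordinate direction becomes a vector [cone_dir i]
    with positive entries, as [kernel_line] requires of the direction of a line. *)
Definition cone (t : 'I_d -> C) : 'rV[C]_d := \row_k (t k + \sum_i t i).

Definition cone_dir (i : 'I_d) : 'rV[C]_d := \row_k ((k == i)%:R + 1).

Lemma cone_upd t i x : cone (upd t i x) = cone (upd t i 0) + x *: cone_dir i.
Proof.
apply/rowP => k; rewrite !mxE (bigD1 i) //= [X in _ = _ + X + _](bigD1 i) //=.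
have e y : \sum_(j | j != i) upd t i y j = \sum_(j | j != i) t j.
  by apply: eq_bigr => j /negbTE ji; rewrite /upd ji.
by rewrite !e /upd eqxx; case: eqP => _ /=; ring.
Qed.

Lemma upd_id (t : 'I_d -> C) i : upd t i (t i) = t.
Proof. by apply/funext => l; rewrite /upd; case: eqP => [->|]. Qed.

Lemma cone_line t i : cone t = cone (upd t i 0) + t i *: cone_dir i.
Proof. by rewrite -cone_upd upd_id. Qed.

Lemma cone_surj z : exists t, cone t = z.
Proof.
(* Summing the coordinates of [cone t] multiplies the sum of the [t i] by [d + 1], so [s] is that
   sum. *)
pose s := (\sum_k z 0 k) / d.+1%:R.
have d0 : (d.+1%:R : C) != 0 by rewrite pnatr_eq0.
exists (fun k => z 0 k - s); apply/rowP => k; rewrite !mxE.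
rewrite big_split /= sumr_const card_ord.
suff -> : \sum_i z 0 i + (- s) *+ d = s by rewrite subrK.
by rewrite -[X in X + _](divfK d0) -/s mulr_natr mulrS mulNrn addrK.
Qed.

Lemma cone_gt0 t : (forall i, 0 < t i) -> forall k, 0 < cone t 0 k.
Proof.
by move=> t0 k; rewrite mxE ltr_wpDr // sumr_ge0 // => i _; exact: ltW.
Qed.

Lemma gt0_polyhalfplane (z : 'rV[C]_d) : (forall k, 0 < z 0 k) -> polyhalfplane z.
Proof.
by move=> z0 k; move: (z0 k); rewrite -{1}(Creal_ReP _ (gtr0_real (z0 k))).
Qed.

(** Interpolation expresses every value of [p] through its values on the grid, whose nodes are
    positive. *)
Lemma mpoly_vanish (p : mpoly d C) :
  (forall t, (forall i, 0 < t i) -> mev p (cone t) = 0) -> forall z, mev p z = 0.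
Proof.
move=> p0 z; have [t <-] := cone_surj z; have [M MP] := line_restriction p.
have [//|a aP] := @grid_interpolation C d M.+1 (fun=> True) t isT (fun=> I).
rewrite (aP (fun t => mev p (cone t))) => [|i t' _].
  by rewrite big1 // => J _; rewrite p0 ?mulr0 // => i; exact: node_gt0.
have [P PM PE] := MP (cone (upd t' i 0)) (cone_dir i).
rewrite (cone_line t' i) -PE (@poly_lagrange _ M.+1) //; last exact: leqW.
by apply: eq_bigr => j _; rewrite PE -cone_upd.
Qed.

(** On the line joining [z1] to [z] both restrict to polynomials in one variable with zero product,
    and the one of [q] is not zero. *)
Lemma mpoly_mul_vanish (p q : mpoly d C) z1 : mev q z1 != 0 ->
  (forall z, mev q z * mev p z = 0) -> forall z, mev p z = 0.
Proof.
move=> q1 qp z; have [M1 /(_ z1 (z - z1)) [Q _ QE]] := line_restriction q.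
have [M2 /(_ z1 (z - z1)) [P _ PE]] := line_restriction p.
have : Q * P = 0.
  have h t : (Q * P).[t] = 0 by rewrite hornerM QE PE qp.
  apply/eqP/negPn/negP => QP0.
  have := max_poly_roots QP0
    (_ : all (root (Q * P)) [seq node j | j <- iota 0 (size (Q * P))]).
  rewrite size_map size_iota ltnn => F; suff : false by []; apply: F.
    by apply/allP => x _; rewrite rootE h.
  by rewrite map_inj_uniq ?iota_uniq //; exact: node_inj.
move=> /eqP; rewrite mulf_eq0 => /orP[/eqP Q0|/eqP P0].
  by move: q1; have := QE 0; rewrite scale0r addr0 Q0 horner0 => <-; rewrite eqxx.
by have := PE 1; rewrite scale1r addrC subrK P0 horner0.
Qed.

End Regular.

(** * Finite rank of the kernels of a rational function *)

Section KernelToSchur.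
Context {C : numClosedFieldType}.

Lemma kernel_grid d n (f : 'rV[C]_d -> 'M[C]_n) Phi (q : mpoly d C)
    (p : 'I_n -> 'I_n -> mpoly d C) :
  (forall k, positive_kernel (@polyhalfplane C d) (Phi k)) ->
  (forall w z, polyhalfplane w -> polyhalfplane z ->
     f z = \sum_(k < d) z 0 k *: Phi k w z) ->
  (forall i j z, polyhalfplane z -> mev q z * f z i j = mev (p i j) z) ->
  exists N (Z : 'I_N -> 'rV[C]_d), (forall a, polyhalfplane (Z a)) /\
    forall t, (forall i, 0 < t i) -> mev q (cone t) != 0 ->
      exists c : 'I_N -> C, forall k w, polyhalfplane w ->
        Phi k w (cone t) = \sum_a c a *: Phi k w (Z a).
Proof.
move=> Phi_pos fE qf.
have [Mq MqP] := line_restriction q.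
have /fin_all_exists [Mp MpP] : forall ij : 'I_n * 'I_n, exists M,
    forall x y : 'rV[C]_d, exists2 P : {poly C},
    (size P <= M)%N & forall t, P.[t] = mev (p ij.1 ij.2) (x + t *: y).
  by move=> ij; exact: line_restriction.
(* [M] nodes suffice for [q] and for all numerators on every line; the successor makes [M]
   positive. *)
pose M := (maxn Mq (\max_ij Mp ij)).+1.
pose J := {ffun 'I_d -> 'I_M}.
pose Z (a : 'I_#|{: J}|) := cone (fun i => node (enum_val a i) : C).
have conP t : (forall i, 0 < t i) -> polyhalfplane (cone t : 'rV[C]_d).
  by move=> t0; apply: gt0_polyhalfplane; exact: cone_gt0.
exists #|{: J}|, Z; split=> [a|t t0 qt].
  by apply: conP => i; exact: node_gt0.
have [a aP] := @grid_interpolation C d M (fun x => 0 < x) t isT (@node_gt0 C) t0.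
(* What is interpolated is [q Phi k w], so the coefficients carry [q] at the nodes and are divided
   by [q] at [cone t]. *)
exists (fun J0 => (mev q (cone t))^-1 * (a (enum_val J0) * mev q (Z J0))) => k w wP.
apply/matrixP => i j; rewrite summxE; under eq_bigr => b _ do rewrite mxE -mulrA.
rewrite -mulr_sumr; apply: (mulfI qt); rewrite mulrA mulfV // mul1r.
pose h t := mev q (cone t) * Phi k w (cone t) i j.
rewrite -/(h t) (aP h) => [|l t' t'0].
  rewrite (reindex_onto (@enum_val _ (mem {: J})) enum_rank) /=; last first.
    by move=> b _; rewrite enum_rankK.
  by apply: eq_big => [b|b _]; rewrite ?enum_valK ?eqxx // /h mulrA.
(* Moving the [l]-th parameter follows a line with nonnegative base point and positive direction, so
   [kernel_line] applies. *)
have xge0 k0 : 0 <= cone (upd t' l 0) 0 k0.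
  rewrite mxE /upd addr_ge0 ?sumr_ge0 //; first by case: ifP => // _; exact: ltW.
  by move=> i0 _; case: ifP => // _; exact: ltW.
have ygt0 k0 : 0 < cone_dir (C := C) l 0 k0 by rewrite mxE ltr_wpDl.
have [Q QM QE] := MqP (cone (upd t' l 0)) (cone_dir l).
have /fin_all_exists [P PP] : forall ij : 'I_n * 'I_n, exists P : {poly C},
    (size P <= Mp ij)%N /\
    forall t, P.[t] = mev (p ij.1 ij.2) (cone (upd t' l 0) + t *: cone_dir l).
  by move=> ij; have [P] := MpP ij (cone (upd t' l 0)) (cone_dir l); exists P.
pose p' : 'M[{poly C}]_n := \matrix_(i0, j0) P (i0, j0).
have QM' : (size Q <= M)%N by rewrite (leq_trans QM) // leqW // leq_maxl.
have PM i0 j0 : (size (p' i0 j0) <= M)%N.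
  rewrite mxE (leq_trans (PP _).1) // leqW // leq_max.
  by rewrite (leq_bigmax (i0, j0)) orbT.
have QP (s : C) : 0 < s -> forall i0 j0,
    Q.[s] * f (cone (upd t' l 0) + s *: cone_dir l) i0 j0 = (p' i0 j0).[s].
  move=> s0 i0 j0; rewrite mxE QE (PP _).2 qf //; apply: gt0_polyhalfplane => k0.
  by rewrite mxE ltr_wpDl // mxE mulr_gt0.
have := kernel_line Phi_pos fE xge0 ygt0 k (isT : 0 < M)%N QM' PM QP (t'0 l) wP.
move=> /matrixP/(_ i j); rewrite mxE summxE QE -cone_line -/(h t') => ->.
by apply: eq_bigr => b _; rewrite mxE QE -cone_upd mulrA.
Qed.

(** Where a fixed denominator [q] does not vanish on the positive cone, the kernels are spanned by
    their grid values and factor in finite dimension, which gives a Schur complement there. It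
    equals [f] on the rest of Pi^d because both are rational near each point. *)
Lemma Schur_data_of_kernels d n (f : 'rV[C]_d -> 'M[C]_n) Phi :
  (forall k, positive_kernel (@polyhalfplane C d) (Phi k)) ->
  (forall w z, polyhalfplane w -> polyhalfplane z ->
     f z = \sum_(k < d) z 0 k *: Phi k w z) ->
  (forall z0, polyhalfplane z0 -> forall i j, regular_at z0 (fun z => f z i j)) ->
  Schur_data (@polyhalfplane C d) f.
Proof.
move=> Phi_pos fE freg.
have conP t : (forall i, 0 < t i) -> polyhalfplane (cone t : 'rV[C]_d).
  by move=> t0; apply: gt0_polyhalfplane; exact: cone_gt0.
have regpair z0 : polyhalfplane z0 -> exists (q : mpoly d C) p, mev q z0 != 0 /\
    forall i j z, polyhalfplane z -> mev q z * f z i j = mev (p i j) z.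
  move=> z0P; have [|q [p [q0 pq]]] :=
    @regular_common_denominator _ d ('I_n * 'I_n)%type z0 (fun ij z => f z ij.1 ij.2).
    by move=> ij; exact: freg.
  by exists q, (fun i j => p (i, j)); split=> // i j z; exact: (pq (i, j)).
pose z1 : 'rV[C]_d := cone (fun=> 1).
have z1P : polyhalfplane z1 by apply: conP => i; exact: ltr01.
have [q [p [q1 qf]]] := regpair z1 z1P.
have [N [Z [ZP grid]]] := kernel_grid Phi_pos fE qf.
have PhiH k w z : polyhalfplane w -> polyhalfplane z -> (Phi k w z) ^t* = Phi k z w.
  exact: (positive_kernel_herm (Phi_pos k)).
have /fin_all_exists [S SP] k := positive_kernel_factor (Phi_pos k) ZP.
pose D : set 'rV[C]_d := [set z | exists2 t, forall i, 0 < t i &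
  z = cone t /\ mev q z != 0].
have DP z : D z -> polyhalfplane z by move=> [t t0 [-> _]]; exact: conP.
have /choice [c cP] : forall z, exists c : 'I_N -> C, D z ->
    forall k w, polyhalfplane w -> Phi k w z = \sum_a c a *: Phi k w (Z a).
  move=> z; have [[t t0 [-> qt]]|nD] := pselect (D z); last by exists (fun=> 0).
  by have [c cP] := grid t t0 qt; exists c.
have [|||m [A [Apsd Ank fA]]] := @Schur_data_of_sums C d n (fun=> \sum_(a < N) n)%N
  (fun k z => \sum_a c z a *: S k a) D f z1.
- by move=> z /DP; exact: polyhalfplane_Omega.
- by exists (fun=> 1) => // i; exact: ltr01.
- move=> w z Dw Dz; have wP := DP _ Dw; have zP := DP _ Dz.
  rewrite (fE w z) //; apply: eq_bigr => k _; congr (_ *: _).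
  (* Expanding in [z], then in [w] through Hermitian symmetry, leaves only grid values, which [SP]
     factors. *)
  rewrite (cP z Dz) // mulmx_sumr; apply: eq_bigr => b _.
  rewrite -scalemxAr -PhiH //; congr (_ *: _).
  rewrite (cP w Dw) // [X in X *m _](_ : _ = \sum_a (c w a)^* *: (S k a)^t*).
    rewrite mulmx_suml; apply/matrixP => i j; rewrite !mxE !summxE rmorph_sum.
    apply: eq_bigr => a _; rewrite -scalemxAl -SP -(PhiH k (Z a)) //.
    by rewrite !mxE rmorphM /= conjCK.
  apply/matrixP => i j; rewrite !mxE !summxE rmorph_sum; apply: eq_bigr => a _.
  by rewrite !mxE rmorphM.
exists m, A; split=> // z0 z0P.
have unitA z : polyhalfplane z -> drsubmx (pencil A z) \in unitmx.
  move=> zP; rewrite drsubmx_pencil; apply: pencil_unitmx => // [k|].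
    exact: psdmx_drsubmx.
  exact: polyhalfplane_Omega.
pose L := mpencil id A; pose s := \det (drsubmx L); pose S0 := schur_num L.
have mevL (z : 'rV[C]_d) : map_mx (meval (fun k => z 0 k)) L = pencil A z.
  by rewrite mev_mpencil; congr pencil; apply/rowP => k; rewrite mxE.
have s0 z : polyhalfplane z -> mev s z != 0.
  move=> /unitA; rewrite unitmxE unitfE -mevL -map_drsubmx.
  by rewrite /s /mev -det_map_mx.
have schurE z i j : polyhalfplane z ->
    mev s z * schur (pencil A z) i j = mev (S0 i j) z.
  move=> zP; rewrite -mevL schur_map; last exact: s0.
  by rewrite !mxE mulrA mulfV ?mul1r //; exact: s0.
have [q' [p' [q'0 qf']]] := regpair z0 z0P.
apply/matrixP => i j.
(* [E] is the cross-multiplied difference of the Schur complement and [f], with a denominator [q']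
   of [f] that is nonzero at [z0]. The product [q E] vanishes on the positive cone, hence
   identically, and [q] is nonzero at [z1]. *)
pose E := q' * S0 i j - p' i j * s.
have EE (z : 'rV[C]_d) : mev E z = mev q' z * mev (S0 i j) z - mev (p' i j) z * mev s z.
  by rewrite /mev mevalB !mevalM.
have E0 : mev E z0 = 0.
  apply: (mpoly_mul_vanish q1) => z; rewrite /mev -mevalM -/(mev (q * E) z).
  move: z; apply: mpoly_vanish => t t0; rewrite /mev mevalM -/(mev q _) -/(mev E _).
  have [->|qt] := eqVneq (mev q (cone t)) 0; first by rewrite mul0r.
  have ctP := conP _ t0; rewrite EE -schurE // -qf' // fA; last by exists t.
  by ring.
apply: (mulfI q'0); apply: (mulfI (s0 _ z0P)).
move: E0; rewrite EE -qf' // -schurE //.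
by move=> /eqP; rewrite subr_eq0 => /eqP h; rewrite mulrC -h mulrCA.
Qed.

End KernelToSchur.

(** * Rational functions *)

Section RationalValues.
Context {C : numClosedFieldType}.

Lemma tofrac_div_eq (R : idomainType) (p q p' q' : R) :
  q != 0 -> q' != 0 ->
  FracField.tofrac p / FracField.tofrac q = FracField.tofrac p' / FracField.tofrac q' ->
  p' * q = p * q'.
Proof.
move=> q0 q'0 h; apply/eqP; rewrite -(tofrac_eq (p' * q)) (tofracM p') (tofracM p).
by rewrite -(@eqr_div {fraction R}) ?tofrac_eq0 //; apply/eqP/esym.
Qed.

Lemma mev_neq0 d (q : mpoly d C) z : mev q z != 0 -> q != 0.
Proof. by apply: contraNneq => ->; rewrite /mev meval0. Qed.

Lemma ratvalue_frac d (p q : mpoly d C) z c : mev q z != 0 ->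
  ratvalue (FracField.tofrac p / FracField.tofrac q) z c <-> c = mev p z / mev q z.
Proof.
move=> qz; split=> [[p' [q' [pq q'z ->]]]|->]; last by exists p, q.
have q'z' : mev q' z != 0 by [].
move: (tofrac_div_eq (mev_neq0 qz) (mev_neq0 q'z') pq)
  => /(congr1 (fun r => mev r z)); rewrite /mev !mevalM => h.
by apply/eqP; rewrite eqr_div //; apply/eqP.
Qed.

(** Here [q] may vanish at [z]: the value is supplied by another fraction, and cross-multiplication
    compares the two. *)
Lemma ratvalue_clear d (p q : mpoly d C) z c : q != 0 ->
  ratvalue (FracField.tofrac p / FracField.tofrac q) z c -> mev q z * c = mev p z.
Proof.
move=> q0 [p' [q' [pq q'z ->]]].
have q'z' : mev q' z != 0 by [].
move: (tofrac_div_eq q0 (mev_neq0 q'z') pq)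
  => /(congr1 (fun r => mev r z)); rewrite /mev !mevalM => h.
by apply: (mulIf q'z'); rewrite -mulrA divfK // mulrC.
Qed.

Lemma rational_on_quotient d p q (D : set 'rV[C]_d) (g : 'rV[C]_d -> 'M[C]_(p, q))
    (s : mpoly d C) (Q : 'M[mpoly d C]_(p, q)) :
  (forall z, D z -> mev s z != 0) ->
  (forall z, D z -> g z = (mev s z)^-1 *: map_mx (meval (fun k => z 0 k)) Q) ->
  rational_on D g.
Proof.
move=> s0 gE; exists (\matrix_(i, j) (FracField.tofrac (Q i j) / FracField.tofrac s)).
move=> z Dz i j; rewrite mxE; apply/ratvalue_frac; first exact: s0.
by rewrite gE // !mxE mulrC.
Qed.

Lemma regular_at_of_rational d n (D : set 'rV[C]_d) (g : 'rV[C]_d -> 'M[C]_n) z0 :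
  @polyhalfplane C d `<=` D -> rational_on D g -> polyhalfplane z0 ->
  forall i j, regular_at z0 (fun z => g z i j).
Proof.
move=> PD [r rg] z0P i j; have [p [q [rE qz0 _]]] := rg z0 (PD _ z0P) i j.
exists p, q; split=> // z zP; have := rg z (PD _ zP) i j.
by rewrite rE; apply: ratvalue_clear; exact: (@mev_neq0 _ _ z0).
Qed.

Lemma regular_at_of_sesquirational d n (D : set 'rV[C]_d)
    (Phi : 'rV[C]_d -> 'rV[C]_d -> 'M[C]_n) w z0 :
  @polyhalfplane C d `<=` D -> sesquirational_on D Phi -> D w -> polyhalfplane z0 ->
  forall i j, regular_at z0 (fun z => Phi w z i j).
Proof.
move=> PD [r rP] Dw z0P i j; have [p [q [rE qz0 _]]] := rP w z0 Dw (PD _ z0P) i j.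
(* Freezing [w]: the first [d] variables become the constants conj [w], the last [d] remain
   variables. *)
pose u : (d + d).-tuple (mpoly d C) := [tuple
  match fintype.split k with inl l => mpolyC d (w 0 l)^* | inr l => mpolyX C (mnm1 l) end
  | k < d + d].
have uE (p0 : mpoly (d + d) C) (z : 'rV[C]_d) :
    mev (comp_mpoly u p0) z = mev p0 (row_mx (map_mx Num.conj w) z).
  rewrite /mev comp_mpoly_meval; apply: meval_eq => k; rewrite tnth_mktuple mxE.
  by case: fintype.split => l; rewrite ?mevalC ?mevalXU ?mxE.
exists (comp_mpoly u p), (comp_mpoly u q); rewrite uE; split=> // z zP.
rewrite !uE; apply: ratvalue_clear; first exact: mev_neq0 qz0.
by rewrite -rE; exact: (rP w z Dw (PD _ zP) i j).
Qed.

End RationalValues.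

(** * Rational Schur complements of pencils *)

Section SchurClasses.
Context {C : numClosedFieldType} (d n : nat) (f : 'rV[C]_d -> 'M[C]_n).

Lemma const1_polyhalfplane : polyhalfplane (const_mx 1 : 'rV[C]_d).
Proof. by apply: gt0_polyhalfplane => k; rewrite mxE ltr01. Qed.

(** A common kernel vector of the constant matrices would, as a constant vector, be killed by the
    formal pencil [A_22], whose determinant is not zero. *)
Lemma Schur_data_of_Bclass r : Bclass r -> restriction (@polyhalfplane C d) r f ->
  Schur_data (@polyhalfplane C d) f.
Proof.
move=> [m [A [Apsd detL ->]]] rf; exists m, A.
have detE : \det (drsubmx (mxpencil A)) =
    FracField.tofrac (\det (drsubmx (mpencil id A))).
  by rewrite mxpencilE -map_drsubmx det_map_mx.
have Ank (x : 'cV[C]_m) : (forall k, drsubmx (A k) *m x = 0) -> x = 0.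
  move=> Ax; pose y := map_mx (@ratcst C d) x.
  have : drsubmx (mxpencil A) *m y = 0.
    have -> : drsubmx (mxpencil A) =
        \sum_k ratvar C k *: map_mx (@ratcst C d) (drsubmx (A k)).
      apply/matrixP => i j; rewrite !mxE !summxE.
      by apply: eq_bigr => k _; rewrite !mxE.
    rewrite mulmx_suml big1 // => k _; rewrite -scalemxAl.
    rewrite -(map_mxM (@FracField.tofrac (mpoly d C) \o @mpolyC d C)) Ax.
    by rewrite map_mx0 scaler0.
  move=> /(congr1 (mulmx (invmx (drsubmx (mxpencil A))))).
  rewrite mulKmx ?unitmxE ?unitfE // mulmx0 => /matrixP y0.
  apply/matrixP => i j; have := y0 i j; rewrite !mxE => /eqP.
  by rewrite tofrac_eq0 mpolyC_eq0 => /eqP.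
split=> // z zP.
have mevL : map_mx (meval (fun k => z 0 k)) (mpencil id A) = pencil A z.
  by rewrite mev_mpencil; congr pencil; apply/rowP => k; rewrite mxE.
have sz : mev (\det (drsubmx (mpencil id A))) z != 0.
  rewrite /mev -det_map_mx map_drsubmx mevL drsubmx_pencil -unitfE -unitmxE.
  apply: pencil_unitmx => // [k|]; first exact: psdmx_drsubmx.
  exact: polyhalfplane_Omega.
rewrite -mevL schur_map //; apply/matrixP => i j; have := rf z zP i j.
rewrite -[_ - _]/(schur _) mxpencilE schur_map; last first.
  by rewrite tofrac_eq0 (mev_neq0 sz).
by rewrite !mxE mulrC => /ratvalue_frac -> //; rewrite mulrC.
Qed.

Context (m : nat) (A : 'I_d -> 'M[C]_(n + m)).
Hypothesis Apsd : forall k, psdmx (A k).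
Hypothesis Ank : forall x : 'cV[C]_m, (forall k, drsubmx (A k) *m x = 0) -> x = 0.
Hypothesis fA : forall z, polyhalfplane z -> f z = schur (pencil A z).

Lemma unit_pencil22 z : Omega z -> drsubmx (pencil A z) \in unitmx.
Proof.
by move=> zO; rewrite drsubmx_pencil; apply: pencil_unitmx => // k;
  exact: psdmx_drsubmx.
Qed.

Lemma mev_mpencil_id (z : 'rV[C]_d) :
  map_mx (meval (fun k => z 0 k)) (mpencil id A) = pencil A z.
Proof. by rewrite mev_mpencil; congr pencil; apply/rowP => k; rewrite mxE. Qed.

Lemma mev_det22_neq0 z : Omega z -> mev (\det (drsubmx (mpencil id A))) z != 0.
Proof.
move=> /unit_pencil22.
by rewrite unitmxE unitfE -mev_mpencil_id -map_drsubmx det_map_mx.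
Qed.

Lemma Bclass_of_schur :
  exists2 r : 'M[ratfun C d]_n, Bclass r & restriction (@polyhalfplane C d) r f.
Proof.
have s0 : \det (drsubmx (mpencil id A)) != 0.
  exact: mev_neq0 (mev_det22_neq0 (polyhalfplane_Omega const1_polyhalfplane)).
exists (schur (mxpencil A)); first exists m, A.
  by split=> //; rewrite mxpencilE -map_drsubmx det_map_mx tofrac_eq0.
move=> z zP i j; rewrite mxpencilE schur_map ?tofrac_eq0 // !mxE mulrC.
have sz := mev_det22_neq0 (polyhalfplane_Omega zP).
apply/ratvalue_frac => //.
by rewrite fA // -mev_mpencil_id schur_map // !mxE mulrC.
Qed.

(** With [S] a factor of [A k], these are the functions [phi_k] of (2'). *)
Lemma rational_schur_sol N (S : 'M[C]_(N, n + m)) :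
  rational_on (@Omega C d) (fun z => S *m schur_sol (pencil A z)).
Proof.
pose L := mpencil id A; pose s := \det (drsubmx L).
apply: (rational_on_quotient mev_det22_neq0 (Q := map_mx (@mpolyC d C) S *m
  col_mx s%:M (- (\adj (drsubmx L) *m dlsubmx L)))) => z zO.
have sz := mev_det22_neq0 zO.
rewrite map_mxM map_col_mx map_mxN map_mxM map_mx_adj map_drsubmx map_dlsubmx.
rewrite mev_mpencil_id map_scalar_mx /= scalemxAr; congr (_ *m _).
  by apply/matrixP => i j; rewrite !mxE mevalC.
rewrite scale_col_mx scalerN scalemxAl -/(mev _ z) scale_scalar_mx mulVf //.
rewrite /schur_sol; congr (col_mx _ (- (_ *m _))).
have dE : mev s z = \det (drsubmx (pencil A z)).
  by rewrite -mev_mpencil_id -map_drsubmx det_map_mx.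
by rewrite dE invmx_adj // -dE.
Qed.

Lemma schur_solZ z lam : Omega z -> lam != 0 ->
  schur_sol (pencil A (lam *: z)) = schur_sol (pencil A z).
Proof.
move=> zO l0; rewrite pencilZ /schur_sol; congr (col_mx _ (- _)).
have -> : drsubmx (lam *: pencil A z) = lam *: drsubmx (pencil A z).
  by apply/matrixP => i j; rewrite !mxE.
have -> : dlsubmx (lam *: pencil A z) = lam *: dlsubmx (pencil A z).
  by apply/matrixP => i j; rewrite !mxE.
have uA := unit_pencil22 zO.
by rewrite invmxZ ?unitmxZ ?unitfE // -scalemxAl -scalemxAr scalerA mulVf ?scale1r.
Qed.

(** [A(z) V(z)] has lower block zero and the upper block of [V(w)] is the identity, so
    [V(w)^* A(z) V(z)] is the Schur complement for every [w]. *)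
Lemma schur_sumE w z : Omega w -> Omega z ->
  schur (pencil A z) = \sum_k z 0 k *:
    ((schur_sol (pencil A w)) ^t* *m A k *m schur_sol (pencil A z)).
Proof.
move=> wO zO; transitivity ((schur_sol (pencil A w)) ^t* *m
    (pencil A z *m schur_sol (pencil A z))).
  rewrite mul_schur_sol ?unit_pencil22 // {1}/schur_sol tr_col_mx map_row_mx.
  by rewrite mul_row_col mulmx0 addr0 trmx1 map_mx1 mul1mx.
rewrite /pencil mulmx_suml mulmx_sumr; apply: eq_bigr => k _.
by rewrite -scalemxAl -scalemxAr mulmxA.
Qed.

End SchurClasses.

(** * Rationality and positivity of the kernels of a pencil *)

Section KernelClasses.
Context {C : numClosedFieldType}.

Lemma sesquirational_on_quotient d p q (D : set 'rV[C]_d)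
    (Phi : 'rV[C]_d -> 'rV[C]_d -> 'M[C]_(p, q))
    (s : mpoly (d + d) C) (Q : 'M[mpoly (d + d) C]_(p, q)) :
  (forall w z, D w -> D z -> let x := row_mx (map_mx Num.conj w) z in
     mev s x != 0 /\
     Phi w z = (mev s x)^-1 *: map_mx (meval (fun k => x 0 k)) Q) ->
  sesquirational_on D Phi.
Proof.
move=> h; exists (\matrix_(i, j) (FracField.tofrac (Q i j) / FracField.tofrac s)).
move=> w z Dw Dz i j; have [sx ->] := h w z Dw Dz.
by rewrite mxE; apply/ratvalue_frac => //; rewrite !mxE mulrC.
Qed.

Lemma Omega_conj d (w : 'rV[C]_d) : Omega w -> Omega (map_mx Num.conj w).
Proof.
move=> [a [a1 [z zP ->]]]; exists a^*; split; first by rewrite norm_conjC.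
exists (map_mx Num.conj z) => [k|]; first by rewrite mxE Re_conj zP.
by rewrite map_mxZ.
Qed.

Lemma psdmx_herm n (A : 'M[C]_n) : psdmx A -> A ^t* = A.
Proof. by move=> [/hermsymmxP]. Qed.

Lemma pencil_ct d n (A : 'I_d -> 'M[C]_n) w : (forall k, psdmx (A k)) ->
  (pencil A w) ^t* = pencil A (map_mx Num.conj w).
Proof.
move=> Apsd; apply/matrixP => i j; rewrite !mxE !summxE rmorph_sum.
apply: eq_bigr => k _; rewrite !mxE rmorphM /=; congr (_ * _).
by rewrite -{2}(psdmx_herm (Apsd k)) !mxE.
Qed.

(** For a Hermitian pencil this row, taken at conj [w], is the adjoint of [V(w)], which is thereby
    rational in conj [w]. *)
Definition schur_row (F : comUnitRingType) n m (L : 'M[F]_(n + m)) :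
    'M[F]_(n, n + m) :=
  row_mx 1%:M (- (ursubmx L *m invmx (drsubmx L))).

Lemma schur_sol_ct d n m (A : 'I_d -> 'M[C]_(n + m)) w : (forall k, psdmx (A k)) ->
  (schur_sol (pencil A w)) ^t* = schur_row (pencil A (map_mx Num.conj w)).
Proof.
move=> Apsd; rewrite -pencil_ct // /schur_sol /schur_row tr_col_mx map_row_mx.
rewrite trmx1 map_mx1 [(- _)^T]raddfN map_mxN /= ctmxM trmx_inv map_invmx.
by rewrite trmx_dlsub trmx_drsub map_ursubmx map_drsubmx.
Qed.

Lemma schur_row_map (R : comNzRingType) (F : fieldType) (h : {rmorphism R -> F})
    n m (L : 'M[R]_(n + m)) (s := \det (drsubmx L)) :
  h s != 0 -> map_mx h (row_mx s%:M (- (ursubmx L *m \adj (drsubmx L)))) =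
              h s *: schur_row (map_mx h L).
Proof.
move=> hs; have dE : \det (drsubmx (map_mx h L)) = h s.
  by rewrite -map_drsubmx det_map_mx.
rewrite map_row_mx map_mxN map_mxM map_mx_adj map_drsubmx map_ursubmx map_scalar_mx.
rewrite scale_row_mx scale_scalar_mx mulr1 scalerN scalemxAr invmx_adj ?dE //.
by rewrite scalerA mulfV // scale1r.
Qed.

Lemma schur_sol_map (R : comNzRingType) (F : fieldType) (h : {rmorphism R -> F})
    n m (L : 'M[R]_(n + m)) (s := \det (drsubmx L)) :
  h s != 0 -> map_mx h (col_mx s%:M (- (\adj (drsubmx L) *m dlsubmx L))) =
              h s *: schur_sol (map_mx h L).
Proof.
move=> hs; have dE : \det (drsubmx (map_mx h L)) = h s.
  by rewrite -map_drsubmx det_map_mx.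
rewrite map_col_mx map_mxN map_mxM map_mx_adj map_drsubmx map_dlsubmx map_scalar_mx.
rewrite scale_col_mx scale_scalar_mx mulr1 scalerN scalemxAl invmx_adj ?dE //.
by rewrite scalerA mulfV // scale1r.
Qed.

Lemma sesquirational_kernel d n m (A : 'I_d -> 'M[C]_(n + m)) k :
  (forall k, psdmx (A k)) ->
  (forall x : 'cV[C]_m, (forall k, drsubmx (A k) *m x = 0) -> x = 0) ->
  sesquirational_on (@Omega C d) (fun w z =>
    (schur_sol (pencil A w)) ^t* *m A k *m schur_sol (pencil A z)).
Proof.
move=> Apsd Ank.
(* [L1] is the pencil in the variables conj [w], [L2] the pencil in the variables [z]. *)
pose L1 := mpencil (@lshift d d) A; pose L2 := mpencil (@rshift d d) A.
pose s1 := \det (drsubmx L1); pose s2 := \det (drsubmx L2).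
apply: (@sesquirational_on_quotient _ _ _ _ _ (s1 * s2)
  (row_mx s1%:M (- (ursubmx L1 *m \adj (drsubmx L1))) *m
   map_mx (@mpolyC (d + d) C) (A k) *m
   col_mx s2%:M (- (\adj (drsubmx L2) *m dlsubmx L2)))) => w z wO zO x.
have mL1 : map_mx (meval (fun k => x 0 k)) L1 = pencil A (map_mx Num.conj w).
  by rewrite mev_mpencil; congr pencil; apply/rowP => l; rewrite mxE row_mxEl.
have mL2 : map_mx (meval (fun k => x 0 k)) L2 = pencil A z.
  by rewrite mev_mpencil; congr pencil; apply/rowP => l; rewrite mxE row_mxEr.
have e1 : mev s1 x != 0.
  rewrite /mev -det_map_mx map_drsubmx mL1 -unitfE -unitmxE.
  exact: unit_pencil22 (Omega_conj wO).
have e2 : mev s2 x != 0.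
  rewrite /mev -det_map_mx map_drsubmx mL2 -unitfE -unitmxE.
  exact: unit_pencil22 zO.
rewrite [mev (s1 * s2) x]mevalM; split; first exact: mulf_neq0 e1 e2.
rewrite map_mxM [map_mx _ (_ *m map_mx _ _)]map_mxM.
rewrite schur_row_map; last exact: e1.
rewrite schur_sol_map; last exact: e2.
rewrite mL1 mL2 schur_sol_ct //.
rewrite -2!scalemxAl -scalemxAr scalerA scalerA.
rewrite [X in X *: _](_ : _ = 1); last first.
  by rewrite -mulrA; exact: mulVf (mulf_neq0 e1 e2).
rewrite scale1r.
by congr (_ *m _ *m _); apply/matrixP => i j; rewrite !mxE /= mevalC.
Qed.

Lemma positive_kernel_gram (T : Type) n N (D : set T) (V : T -> 'M[C]_(N, n)) A :
  psdmx A -> positive_kernel D (fun w z => (V w) ^t* *m A *m V z).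
Proof.
move=> /psdmx_factor [S ->] r l u _.
pose x := \sum_j S *m V (l j) *m u j.
suff -> : \sum_i \sum_j ((u i) ^t* *m ((V (l i)) ^t* *m (S ^t* *m S) *m V (l j)
    *m u j)) 0 0 = (x ^t* *m x) 0 0 by exact: cv_sqnorm_ge0.
have -> : x ^t* = \sum_i (S *m V (l i) *m u i) ^t*.
  apply/matrixP => a b; rewrite !mxE !summxE rmorph_sum.
  by apply: eq_bigr => i _; rewrite !mxE.
rewrite mulmx_suml summxE; apply: eq_bigr => i _.
rewrite mulmx_sumr summxE; apply: eq_bigr => j _.
by rewrite !ctmxM !mulmxA.
Qed.

End KernelClasses.

(** * Hilbert space representations *)

Section HilbertKernels.
Context {C : numClosedFieldType} (d n : nat) (H : lmodType C).
Context (dot : {dot H for Num.conj}).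
Local Notation W := ('cV[C]_n * H)%type.

Lemma dot_sum_suml (I : finType) (a : I -> C) (x : I -> W) (y : W) :
  dot_sum dot (\sum_i a i *: x i) y = \sum_i a i * dot_sum dot (x i) y.
Proof.
elim/big_rec2: _ => [|i s t _ <-].
  by rewrite /dot_sum /= mulmx0 mxE linear0l addr0.
by rewrite /dot_sum /= mulmxDr -scalemxAr !mxE linearDl linearZl_LR /=; ring.
Qed.

Lemma dot_sum_sumr (I : finType) (a : I -> C) (x : W) (y : I -> W) :
  dot_sum dot x (\sum_i a i *: y i) = \sum_i (a i)^* * dot_sum dot x (y i).
Proof.
elim/big_rec2: _ => [|i s t _ <-].
  by rewrite /dot_sum /= trmx0 map_mx0 mul0mx mxE linear0r addr0.
rewrite /dot_sum /= linearD linearZ /= map_mxD map_mxZ mulmxDl -scalemxAl !mxE.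
by rewrite linearDr linearZr_LR /=; ring.
Qed.

(** The quadratic form of the kernel is [<A x, x>] for the combination [x] of the vectors
    [V (l j) b] with the entries of the [u j] as coefficients. *)
Lemma positive_kernel_Hilbert (A : {linear W -> W}) (T : Type) (D : set T)
    (V : T -> 'I_n -> W) :
  (forall x, 0 <= dot_sum dot (A x) x) ->
  positive_kernel D (fun w z =>
    \matrix_(i, j) dot_sum dot (A (V z j)) (V w i)).
Proof.
move=> Apos N l u _.
pose x := \sum_(p : 'I_N * 'I_n) u p.1 p.2 0 *: V (l p.1) p.2.
suff -> : \sum_i \sum_j ((u i) ^t* *m ((\matrix_(a, b)
    dot_sum dot (A (V (l j) b)) (V (l i) a)) *m u j)) 0 0 = dot_sum dot (A x) x.
  exact: Apos.
rewrite [A x]linear_sum /=.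
under [X in dot_sum _ X _]eq_bigr => p _ do rewrite linearZ /=.
rewrite dot_sum_suml; under [RHS]eq_bigr => p _ do rewrite dot_sum_sumr.
rewrite -(pair_bigA _ (fun j b => u j b 0 * \sum_(q : 'I_N * 'I_n)
  (u q.1 q.2 0)^* * dot_sum dot (A (V (l j) b)) (V (l q.1) q.2))) /=.
rewrite exchange_big /=; apply: eq_bigr => j _.
under [RHS]eq_bigr => b _ do rewrite -(pair_bigA _ (fun i a =>
  (u i a 0)^* * dot_sum dot (A (V (l j) b)) (V (l i) a))) /= mulr_sumr.
rewrite [RHS]exchange_big /=; apply: eq_bigr => i _.
transitivity (\sum_a \sum_b
    (u i a 0)^* * (dot_sum dot (A (V (l j) b)) (V (l i) a) * u j b 0)).
  rewrite mxE; apply: eq_bigr => a _; rewrite mxE [X in _ * X]mxE mulr_sumr.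
  by apply: eq_bigr => b _; rewrite !mxE.
rewrite exchange_big /=; apply: eq_bigr => b _.
by rewrite mulr_sumr; apply: eq_bigr => a _; ring.
Qed.

End HilbertKernels.

(** The matrix computation carries over: [A(z)] sends [V(z) u] to [(g(z) u, 0)], so its inner
    product with [V(w) v] only sees the first component [v]. *)
Lemma kernels_of_Hilbert_representation (C : numClosedFieldType) d n
    (g : 'rV[C]_d -> 'M[C]_n) :
  has_Hilbert_representation g ->
  exists Phi : 'I_d -> 'rV[C]_d -> 'rV[C]_d -> 'M[C]_n,
    (forall k, positive_kernel (@Omega C d) (Phi k)) /\
    forall w z, Omega w -> Omega z -> g z = \sum_k z 0 k *: Phi k w z.
Proof.
move=> [H [dot [A [_ _ Apos rep]]]].
have /choice [S SP] : forall z, exists S : H -> H, Omega z ->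
    cancel S (op22 (oppencil A z)) /\ forall u : 'cV[C]_n,
    g z *m u = op11 (oppencil A z) u -
               op12 (oppencil A z) (S (op21 (oppencil A z) u)).
  move=> z; have [/rep [S [_ _ SK] gE]|nO] := pselect (Omega z).
    by exists S.
  by exists id.
pose V z (u : 'cV[C]_n) : 'cV[C]_n * H := (u, - S z (op21 (oppencil A z) u)).
have LV z u : Omega z -> oppencil A z (V z u) = (g z *m u, 0).
  move=> zO; have [SK gE] := SP z zO.
  have -> : oppencil A z (V z u) =
      oppencil A z (u, 0) - oppencil A z (0, S z (op21 (oppencil A z) u)).
    rewrite /oppencil -sumrB; apply: eq_bigr => k _; rewrite -scalerBr -linearB.
    by congr (_ *: A k (_, _)); rewrite ?subr0 ?sub0r.
  rewrite gE; apply/pair_equal_spec; split=> //=.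
  by apply/eqP; rewrite subr_eq0; apply/eqP/esym; exact: SK.
exists (fun k w z => \matrix_(i, j)
  dot_sum dot (A k (V z (delta_mx j 0))) (V w (delta_mx i 0))); split=> [k|w z wO zO].
  exact: (@positive_kernel_Hilbert C n H dot (A k) _ (@Omega C d)
    (fun z j => V z (delta_mx j 0)) (Apos k)).
apply/matrixP => i j; rewrite summxE; under eq_bigr => k _ do rewrite !mxE.
rewrite -(dot_sum_suml dot (fun k => z 0 k)) -/(oppencil A z _) LV // /dot_sum /=.
rewrite linear0l addr0.
have -> : (delta_mx i 0 : 'cV[C]_n) ^t* = delta_mx 0 i.
  by apply/matrixP => a b; rewrite !mxE andbC; case: (_ && _);
    rewrite ?rmorph0 ?rmorph1.
by rewrite -rowE -colE !mxE.
Qed.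

(** * The double Cayley transform *)

Section BlockDiagonal.
Context {C : numClosedFieldType} (d : nat) (N : 'I_d -> nat).

Definition block_scalar (c : 'rV[C]_d) : 'M[C]_(\sum_k N k) :=
  \mxdiag_k (c 0 k)%:M.

Lemma block_scalarE c :
  block_scalar c = diag_mx (\mxrow_k const_mx (c 0 k)).
Proof. by rewrite diag_mxrow; apply: eq_mxdiag => k; rewrite diag_const_mx. Qed.

Lemma pencil_block_proj c : pencil (block_proj N) c = block_scalar c.
Proof.
rewrite block_scalarE /pencil; apply/matrixP => i j.
rewrite summxE (eq_bigr (fun k =>
  (c 0 k * (tagnat.sig1 i == k)%:R) *+ (i == j))); last first.
  by move=> k _; rewrite !mxE -mulrnAr.
rewrite (bigD1 (tagnat.sig1 i)) //= eqxx [X in _ + X]big1 => [|k].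
  by rewrite addr0 mulr1 !mxE.
by rewrite eq_sym => /negbTE ->; rewrite mulr0 mul0rn.
Qed.

Lemma mul_block_scalar p c (X : 'M[C]_(\sum_k N k, p)) i j :
  (block_scalar c *m X) i j = c 0 (tagnat.sig1 i) * X i j.
Proof. by rewrite block_scalarE mul_diag_mx !mxE. Qed.

End BlockDiagonal.

Section CayleyTransform.
Context {C : numClosedFieldType}.

Definition cayley_inv d (z : 'rV[C]_d) : 'rV[C]_d :=
  \row_k ((z 0 k - 1) / (z 0 k + 1)).

Lemma norm_neq1 (x : C) : `|x| < 1 -> 1 - x != 0.
Proof.
move=> x1; apply: contraTneq x1 => /eqP; rewrite subr_eq0 => /eqP <-.
by rewrite normr1 ltxx.
Qed.

Lemma cayley_re (x : C) : `|x| < 1 -> 0 < 'Re ((1 + x) / (1 - x)).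
Proof.
move=> x1; have x0 := norm_neq1 x1.
have n0 : 0 < `|1 - x| ^+ 2 by rewrite exprn_gt0 // normr_gt0.
rewrite invC_norm mulrCA ReMl; last by rewrite realV ger0_real // exprn_ge0.
rewrite mulr_gt0 ?invr_gt0 // ReE.
rewrite divr_gt0 ?ltr0n //.
have -> : (1 + x) * (1 - x)^* + ((1 + x) * (1 - x)^*)^* = (1 - `|x| ^+ 2) * 2%:R.
  by rewrite normCK rmorphM /= conjCK rmorphB rmorphD rmorph1 /=; ring.
by rewrite mulr_gt0 ?ltr0n // subr_gt0 exprn_ilt1.
Qed.

Lemma cayley_norm (z : C) : 0 < 'Re z -> z + 1 != 0 /\ `|(z - 1) / (z + 1)| < 1.
Proof.
move=> z0.
have key : `|z - 1| ^+ 2 < `|z + 1| ^+ 2.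
  rewrite -subr_gt0 !normCK rmorphB rmorphD rmorph1 /=.
  have -> : (z + 1) * (z^* + 1) - (z - 1) * (z^* - 1) = 'Re z * 4%:R.
    by rewrite ReE; field; rewrite ?pnatr_eq0.
  by rewrite mulr_gt0 ?ltr0n.
have n0 : 0 < `|z + 1| ^+ 2 by rewrite (le_lt_trans _ key) // exprn_ge0.
have z1 : z + 1 != 0 by apply: contraTneq n0 => ->; rewrite normr0 expr0n ltxx.
split=> //; rewrite normf_div ltr_pdivrMr ?normr_gt0 // mul1r.
by rewrite -(ltr_pXn2r (n := 2)) ?nnegrE.
Qed.

Lemma cayley_arg_polyhalfplane d (zeta : 'rV[C]_d) :
  polydisk zeta -> polyhalfplane (cayley_arg zeta).
Proof. by move=> h k; rewrite mxE; exact: cayley_re. Qed.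

Lemma cayley_inv_polydisk d (z : 'rV[C]_d) :
  polyhalfplane z -> polydisk (cayley_inv z).
Proof. by move=> h k; rewrite mxE; have [] := cayley_norm (h k). Qed.

Lemma cayley_invK d (z : 'rV[C]_d) :
  polyhalfplane z -> cayley_arg (cayley_inv z) = z.
Proof.
move=> h; apply/rowP => k; rewrite !mxE; have [z1 _] := cayley_norm (h k).
set x := z 0 k in z1 *; have e : 1 - (x - 1) / (x + 1) = 2%:R / (x + 1) by field.
by rewrite e; field.
Qed.

End CayleyTransform.

(** * Hermitian unitary Givone-Roesser representations *)

Section GivoneRoesser.
Context {C : numClosedFieldType} (d n : nat) (f : 'rV[C]_d -> 'M[C]_n).

Lemma herm_unitary_sq n' (U : 'M[C]_n') :
  U \is unitarymx -> U \is hermsymmx -> U *m U = 1%:M.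
Proof. by move=> /unitarymxP UU /hermsymmxP hU; rewrite -{2}hU. Qed.

(* If U (x, u) = (y, F u), then (x, u) + (y, F u) and (y, F u) - (x, u) belong to
   the eigenspaces of the reflection U for 1 and -1, hence are orthogonal. *)
Lemma Schur_data_of_GR (mk : 'I_d -> nat) (A : 'M[C]_(\sum_k mk k))
    (B : 'M[C]_(\sum_k mk k, n)) (E : 'M[C]_(n, \sum_k mk k)) (D : 'M[C]_n) :
  cayley_defined f -> block_mx A B E D \is unitarymx ->
  block_mx A B E D \is hermsymmx -> GR_representation A B E D (double_cayley f) ->
  Schur_data (@polyhalfplane C d) f.
Proof.
move=> fdef unitU hermU GR; set U := block_mx A B E D in unitU hermU.
have UU : U *m U = 1%:M by exact: herm_unitary_sq.
pose P (z : 'rV[C]_d) := block_scalar mk (cayley_inv z).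
(* [X] is the state fed to [U] and [Y] the state it returns; the factor [b] clears the inverse in
   the Cayley transform. *)
pose X (z : 'rV[C]_d) := invmx (1%:M - P z *m A) *m P z *m B.
pose Y z := A *m X z + B.
pose b z := f z + 1%:M.
pose phi z := 2%:R^-1 *: ((Y z - X z) *m b z).
have XE z : polyhalfplane z -> X z = P z *m Y z.
  move=> zP; have [u _] := GR _ (cayley_inv_polydisk zP).
  apply/eqP; rewrite /Y mulmxDr mulmxA -subr_eq0 opprD addrA.
  rewrite -{1}[X z]mul1mx -mulmxBl /X -!mulmxA mulKVmx // subrr //.
have FE z : polyhalfplane z -> (D + E *m X z) *m b z = f z - 1%:M.
  move=> zP; have [_] := GR _ (cayley_inv_polydisk zP).
  rewrite /double_cayley cayley_invK // => h; rewrite /X !mulmxA -h mulmxKV //.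
  exact: fdef.
have UX z : polyhalfplane z -> U *m col_mx (X z *m b z) (b z) =
    col_mx (Y z *m b z) (f z - 1%:M).
  move=> zP; rewrite mul_block_col (mulmxA A) (mulmxA E) -!mulmxDl -(FE z zP).
  by rewrite [D + _]addrC.
pose s z := col_mx (block_scalar mk z *m phi z) (f z).
pose t z := col_mx (phi z) (- 1%:M : 'M[C]_n).
have half (V : lmodType C) (v : V) : 2%:R^-1 *: (v + v) = v.
  by rewrite -mulr2n -[v *+ 2]scaler_nat scalerA mulVf ?scale1r // pnatr_eq0.
have tE z : t z = 2%:R^-1 *: (col_mx (Y z *m b z) (f z - 1%:M) -
    col_mx (X z *m b z) (b z)).
  rewrite /t opp_col_mx add_col_mx scale_col_mx /phi mulmxBl; congr col_mx.
  by rewrite /b opprD addrACA subrr add0r -opprD scalerN half.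
have sE z : polyhalfplane z -> s z = 2%:R^-1 *: (col_mx (Y z *m b z) (f z - 1%:M) +
    col_mx (X z *m b z) (b z)).
  move=> zP; rewrite /s add_col_mx scale_col_mx; congr col_mx; last first.
    by rewrite /b addrACA addNr addr0 half.
  (* Since [X = P Y], multiplying [Y - X] by [(1 + zeta) / (1 - zeta)] gives [Y + X]. *)
  rewrite /phi -scalemxAr mulmxA -mulmxDl; congr (_ *: (_ *m _)).
  apply/matrixP => i j; rewrite mul_block_scalar.
  have : X z i j = cayley_inv z 0 (tagnat.sig1 i) * Y z i j.
    by rewrite XE // mul_block_scalar.
  move: (X z) (Y z) => x y xE; rewrite !mxE xE mxE.
  have [z1 _] := cayley_norm (zP (tagnat.sig1 i)).
  by field.
have Us z : polyhalfplane z -> U *m s z = s z.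
  move=> zP; rewrite sE // -scalemxAr mulmxDr UX // -(UX z zP) mulmxA UU mul1mx.
  by rewrite addrC.
have Ut z : polyhalfplane z -> U *m t z = - t z.
  move=> zP; rewrite tE // -scalemxAr mulmxBr UX // -(UX z zP) mulmxA UU mul1mx.
  by rewrite -scalerN opprB.
have orth w z : polyhalfplane w -> polyhalfplane z -> (t w) ^t* *m s z = 0.
  move=> wP zP; have h : (t w) ^t* *m s z = - ((t w) ^t* *m s z).
    rewrite -[in LHS](Us z zP) mulmxA -(hermsymmxP _ hermU) -ctmxM Ut //.
    by rewrite [(- _)^T]raddfN map_mxN mulNmx.
  have : (t w) ^t* *m s z *+ 2 = 0 by rewrite mulr2n {1}h addNr.
  by rewrite -[_ *+ 2]scaler_nat => /eqP; rewrite scaler_eq0 pnatr_eq0 => /eqP.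
apply: (@Schur_data_of_features _ _ _ _ _ f (block_proj mk) phi (const_mx 1)).
- exact: polyhalfplane_Omega.
- exact: const1_polyhalfplane.
- exact: psdmx_block_proj.
- exact: sum_block_proj.
move=> w z wP zP; rewrite pencil_block_proj -mulmxA.
have := orth w z wP zP; rewrite /t /s tr_col_mx map_row_mx mul_row_col.
rewrite [(- _)^T]raddfN /= map_mxN trmx1 map_mx1 mulNmx mul1mx => /eqP.
by rewrite subr_eq0 => /eqP.
Qed.

Section OfSchur.
Context (m : nat) (A : 'I_d -> 'M[C]_(n + m)).
Hypothesis Apsd : forall k, psdmx (A k).
Hypothesis Ank : forall x : 'cV[C]_m, (forall k, drsubmx (A k) *m x = 0) -> x = 0.
Hypothesis fA : forall z, polyhalfplane z -> f z = schur (pencil A z).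

(** The form of [f(z)] has nonnegative real part, so a kernel vector [x] of [f(z) + 1] has norm
    zero. *)
Lemma cayley_defined_of_schur : cayley_defined f.
Proof.
move=> z zP; have zO := polyhalfplane_Omega zP; apply: unitmx_ker0 => x h.
apply: cv_sqnorm_eq0.
have : (x ^t* *m f z *m x) 0 0 + (x ^t* *m x) 0 0 = 0.
  have : x ^t* *m ((f z + 1%:M) *m x) = 0 by rewrite h mulmx0.
  by rewrite mulmxDl mul1mx mulmxDr mulmxA => /matrixP/(_ 0 0); rewrite !mxE.
rewrite fA // (schur_sumE Apsd Ank zO zO) mulmx_sumr mulmx_suml summxE.
set V := schur_sol _; pose q k := (x ^t* *m (V ^t* *m A k *m V) *m x) 0 0.
have q_ge0 k : 0 <= q k by exact: (psdmx_congr V (Apsd k)).2.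
rewrite (eq_bigr (fun k => z 0 k * q k)); last first.
  by move=> k _; rewrite -scalemxAr -scalemxAl mxE.
move=> /(congr1 (fun t => 'Re t)) /=; rewrite !raddfD !raddf_sum raddf0 /=.
under eq_bigr => k _ do rewrite /= ReMr ?ger0_real //.
have xx := cv_sqnorm_ge0 x; rewrite (Creal_ReP _ (ger0_real xx)) => /eqP.
rewrite paddr_eq0 // => [/andP[_ /eqP]|] //.
by apply: sumr_ge0 => k _; rewrite mulr_ge0 // ltW // zP.
Qed.

(** The argument of [Schur_data_of_GR] run backwards: [U] is the reflection whose eigenspace for -1
    is the range of [K], built from factors of the [A k] and the projection to C^n. *)
Lemma GR_of_schur : exists (mk : 'I_d -> nat) (A' : 'M[C]_(\sum_k mk k))
    (B : 'M[C]_(\sum_k mk k, n)) (E : 'M[C]_(n, \sum_k mk k)) (D : 'M[C]_n),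
  [/\ block_mx A' B E D \is unitarymx, block_mx A' B E D \is hermsymmx
    & GR_representation A' B E D (double_cayley f)].
Proof.
have /fin_all_exists [S SE] : forall k, exists S : 'M[C]_(n + m), A k = S ^t* *m S.
  by move=> k; exact: psdmx_factor.
pose mk (k : 'I_d) := (n + m)%N.
pose Sc : 'M[C]_(\sum_k mk k, n + m) := \mxcol_k (S k : 'M[C]_(mk k, n + m)).
have ScE c : Sc ^t* *m block_scalar mk c *m Sc = pencil A c.
  rewrite -pencil_block_proj /pencil mulmx_sumr mulmx_suml; apply: eq_bigr => k _.
  rewrite -scalemxAr -scalemxAl /Sc tr_mxcol.
  have -> : map_mx Num.conj (\mxrow_i (S i : 'M[C]_(mk i, n + m))^T) =
      \mxrow_i (S i : 'M[C]_(mk i, n + m))^t*.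
    by apply/matrixP => i j; rewrite !mxE.
  by rewrite mul_block_proj SE.
pose E1 : 'M[C]_(n, n + m) := row_mx 1%:M 0.
pose K := col_mx Sc (- E1).
(* A vector killed by [K] has zero upper part and is killed by every [A k], so its lower part
   vanishes by [Ank]. Hence [K^* K] is invertible and [Pr] is the orthogonal projection onto the
   range of [K]. *)
have K0 x : K *m x = 0 -> x = 0 :> 'cV[C]_(n + m).
  rewrite /K mul_col_mx => /eqP; rewrite col_mx_eq0 => /andP[/eqP Sx].
  rewrite mulNmx oppr_eq0 -{1}[x]vsubmxK /E1 mul_row_col mul1mx mul0mx addr0.
  move=> /eqP ux; have dx : dsubmx x = 0.
    apply: Ank => k; have : A k *m x = 0.
      rewrite SE -mulmxA; have -> : S k *m x = 0; last by rewrite mulmx0.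
      have := Sx; rewrite /Sc mxcol_mul => /(congr1 (fun M => submxcol M k)).
      by rewrite mxcolK submxcol0.
    rewrite -{1}[A k]submxK -{1}[x]vsubmxK ux mul_block_col !mulmx0 !add0r.
    by move=> /eqP; rewrite col_mx_eq0 => /andP[_ /eqP].
  by rewrite -[x]vsubmxK ux dx col_mx0.
pose KK := K ^t* *m K.
have uKK : KK \in unitmx.
  apply: unitmx_ker0 => x KKx; apply: K0; apply: cv_sqnorm_eq0.
  by rewrite ctmxM -mulmxA [K ^t* *m _]mulmxA KKx mulmx0 mxE.
pose Pr := K *m invmx KK *m K ^t*.
have PrK : Pr *m K = K by rewrite /Pr -mulmxA mulmxKV.
have PrH : Pr ^t* = Pr.
  rewrite /Pr !ctmxM trmxCK mulmxA trmx_inv map_invmx; congr (_ *m invmx _ *m _).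
  by rewrite /KK ctmxM trmxCK.
have PrPr : Pr *m Pr = Pr by rewrite {2}/Pr !mulmxA PrK.
pose U := 1%:M - 2%:R *: Pr.
have UH : U ^t* = U.
  rewrite /U [(_ - _)^T]raddfB map_mxB /= trmx1 map_mx1 [(_ *: _)^T]linearZ /=.
  by rewrite map_mxZ rmorph_nat PrH.
have UU : U *m U = 1%:M.
  rewrite /U mulmxBl mul1mx mulmxBr mulmx1 -!scalemxAl -scalemxAr PrPr.
  by move: (Pr) => Q; apply/matrixP => i j; rewrite !mxE; ring.
have UK : U *m K = - K.
  by rewrite /U mulmxBl mul1mx -scalemxAl PrK scaler_nat mulr2n opprD addNKr.
pose A' := ulsubmx U; pose B := ursubmx U; pose E := dlsubmx U; pose D := drsubmx U.
have UE : block_mx A' B E D = U by rewrite submxK.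
exists mk, A', B, E, D; rewrite UE; split.
- by apply/unitarymxP; rewrite UH UU.
- exact/hermsymmxP.
move=> zeta zD; set P := \mxdiag_k _.
have PE i p (X : 'M[C]_(_, p)) j : (P *m X) i j = zeta 0 (tagnat.sig1 i) * X i j.
  exact: mul_block_scalar.
(* [A'] is a contraction, as a corner of a unitary matrix, and [P] shrinks every nonzero vector, so
   [x = P A' x] forces [A' x = 0]. *)
have uP : 1%:M - P *m A' \in unitmx.
  apply: unitmx_ker0 => x; rewrite mulmxBl mul1mx -mulmxA => /eqP.
  rewrite subr_eq0 => /eqP xE; set y := A' *m x in xE.
  suff y0 : y = 0 by rewrite xE y0 mulmx0.
  have le1 : (y ^t* *m y) 0 0 <= (x ^t* *m x) 0 0.
    have h : U *m col_mx x 0 = col_mx y (E *m x).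
      by rewrite -UE mul_block_col !mulmx0 !addr0.
    have : (U *m col_mx x 0) ^t* *m (U *m col_mx x 0) = x ^t* *m x.
      rewrite ctmxM -mulmxA [U ^t* *m _]mulmxA UH UU mul1mx tr_col_mx map_row_mx.
      by rewrite mul_row_col mulmx0 addr0.
    rewrite h tr_col_mx map_row_mx mul_row_col => <-.
    by rewrite [leRHS]mxE lerDl cv_sqnorm_ge0.
  have : \sum_i (1 - `|zeta 0 (tagnat.sig1 i)| ^+ 2) * `|y i 0| ^+ 2 <= 0.
    have -> : \sum_i (1 - `|zeta 0 (tagnat.sig1 i)| ^+ 2) * `|y i 0| ^+ 2 =
        (y ^t* *m y) 0 0 - (x ^t* *m x) 0 0; last by rewrite subr_le0.
      rewrite !cv_sqnorm -sumrB; apply: eq_bigr => i _.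
      by rewrite [in RHS]xE PE normrM exprMn mulrBl mul1r.
  have pos i : 0 < 1 - `|zeta 0 (tagnat.sig1 i)| ^+ 2.
    by rewrite subr_gt0 exprn_ilt1 //; exact: zD.
  have pos' i : 0 <= (1 - `|zeta 0 (tagnat.sig1 i)| ^+ 2) * `|y i 0| ^+ 2.
    by rewrite mulr_ge0 ?exprn_ge0 // ltW.
  move=> le0; have /eqP : \sum_i (1 - `|zeta 0 (tagnat.sig1 i)| ^+ 2) *
      `|y i 0| ^+ 2 = 0.
    by apply/le_anti; rewrite le0 sumr_ge0.
  rewrite psumr_eq0 // => /allP h; apply/colP => i; rewrite [RHS]mxE.
  have := h i (mem_index_enum _); rewrite mulf_eq0 gt_eqF //= expf_eq0 /=.
  by rewrite normr_eq0 => /eqP.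
split=> //; pose z := cayley_arg zeta; have zP : polyhalfplane z.
  exact: cayley_arg_polyhalfplane.
have ub : f z + 1%:M \in unitmx by exact: cayley_defined_of_schur.
pose a := invmx (f z + 1%:M); pose V := schur_sol (pencil A z).
pose phi := Sc *m V *m a; pose Zphi := block_scalar mk z *m phi.
have AV : pencil A z *m V = col_mx (f z) 0.
  by rewrite mul_schur_sol -?fA //; exact: unit_pencil22 (polyhalfplane_Omega zP).
(* [t] lies in the range of [K] and [s] is orthogonal to it. So [U] sends [s - t] to [s + t], whose
   lower blocks are the identity and the Cayley transform of [f]. *)
pose t := col_mx phi (- a); pose s := col_mx Zphi (f z *m a).
have tE : t = K *m (V *m a).
  rewrite /t /K mul_col_mx mulmxA; congr col_mx.
  by rewrite mulNmx mulmxA /E1 mul_row_col mul1mx mul0mx addr0 mul1mx.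
have Ut : U *m t = - t by rewrite tE mulmxA UK mulNmx.
have Ks : K ^t* *m s = 0.
  rewrite /K tr_col_mx map_row_mx mul_row_col /Zphi /phi !mulmxA ScE AV.
  rewrite [(- _)^T]raddfN /= map_mxN !mulNmx /E1 tr_row_mx map_col_mx trmx1 map_mx1.
  by rewrite trmx0 map_mx0 !mul_col_mx !mul1mx !mul0mx subrr.
have Us : U *m s = s.
  by rewrite /U mulmxBl mul1mx -scalemxAl /Pr -!mulmxA Ks !mulmx0 scaler0 subr0.
have bE : f z *m a + a = 1%:M by rewrite -{2}[a]mul1mx -mulmxDl mulmxV.
have FE : f z *m a - a = double_cayley f zeta.
  by rewrite /double_cayley -/z -{2}[a]mul1mx -mulmxBl.
have : U *m (s - t) = s + t by rewrite mulmxBr Us Ut opprK.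
rewrite -UE /s /t opp_col_mx !add_col_mx opprK bE FE mul_block_col !mulmx1.
move=> /eq_col_mx [YE FE'].
have XE : Zphi - phi = P *m (Zphi + phi).
  apply/matrixP => i j; rewrite PE.
  have : Zphi i j = z 0 (tagnat.sig1 i) * phi i j by exact: mul_block_scalar.
  move: (Zphi) (phi) => x y xE; rewrite !mxE xE /z mxE.
  have := norm_neq1 (zD (tagnat.sig1 i)) => ne.
  by field.
have XE' : Zphi - phi = invmx (1%:M - P *m A') *m P *m B.
  rewrite -[LHS](mulKmx uP) -mulmxA; congr (_ *m _).
  rewrite mulmxBl mul1mx {1}XE -YE mulmxDr mulmxA addrC addKr //.
by rewrite -FE' XE' !mulmxA addrC.
Qed.

(** [1 - F(0)] equals twice the inverse of [f + 1] at the corresponding point, which is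
    invertible. *)
Lemma cayley_spectrum_of_schur : ~ spectrum (double_cayley f 0) 1.
Proof.
have z0P : polyhalfplane (cayley_arg (0 : 'rV[C]_d)).
  by apply: cayley_arg_polyhalfplane => k; rewrite mxE normr0 ltr01.
have ub := cayley_defined_of_schur z0P.
rewrite /spectrum /= /double_cayley; set g := f _ in ub *.
rewrite -{1}(mulmxV ub) -mulmxBl opprB addrC addrA subrK => /negP[].
rewrite unitmx_mul unitmx_inv ub andbT -raddfD /= unitmxE det_scalar unitrX //.
by rewrite unitfE -mulr2n pnatr_eq0.
Qed.


End OfSchur.

End GivoneRoesser.

(** * Finite-dimensional Hilbert spaces *)

Section HilbertSpace.
Context (C : numClosedFieldType).

(** A copy of the column vectors that carries the Euclidean norm in place of the sup norm of
    matrices. *)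
Definition l2 (m : nat) : Type := 'cV[C]_m.

HB.instance Definition _ m := GRing.Lmodule.copy (l2 m) 'cV[C]_m.

Definition l2dot m (x y : l2 m) : C := ((y : 'cV[C]_m) ^t* *m x) 0 0.

Definition l2norm m (x : l2 m) : C := sqrtC (l2dot x x).

Lemma l2dotE m (x y : l2 m) : l2dot x y = dotmx (x : 'cV[C]_m)^T (y : 'cV[C]_m)^T.
Proof.
rewrite /l2dot dotmxE !mxE; apply: eq_bigr => i _; rewrite !mxE mulrC.
by congr (_ * _).
Qed.

Lemma l2_normD m (x y : l2 m) : l2norm (x + y) <= l2norm x + l2norm y.
Proof.
rewrite /l2norm !l2dotE raddfD /=.
by have [] := triangle_lerif (@dotmx C m) (x : 'cV[C]_m)^T (y : 'cV[C]_m)^T.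
Qed.

Lemma l2_normZ m (a : C) (x : l2 m) : l2norm (a *: x) = `|a| * l2norm x.
Proof.
rewrite /l2norm !l2dotE linearZ /= dnormZ rootCMl ?exprn_ge0 //.
by rewrite sqrCK.
Qed.

Lemma l2_norm_eq0 m (x : l2 m) : l2norm x = 0 -> x = 0.
Proof. by move=> /eqP; rewrite sqrtC_eq0 => /eqP /cv_sqnorm_eq0. Qed.

HB.instance Definition _ m :=
  Lmodule_isNormed.Build C (l2 m) (@l2_normD m) (@l2_normZ m) (@l2_norm_eq0 m).

Lemma l2dot_bilinear m :
  bilinear_for ( *%R : C -> C -> C) (Num.conj \; *%R) (@l2dot m).
Proof.
split=> [u a x y|u a x y]; rewrite /l2dot.
  by rewrite mulmxDr -scalemxAr !mxE.
by rewrite linearD linearZ /= map_mxD map_mxZ mulmxDl -scalemxAl !mxE.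
Qed.

HB.instance Definition _ m :=
  bilinear_isBilinear.Build C (l2 m) (l2 m) C ( *%R ) (Num.conj \; *%R) (@l2dot m)
    (@l2dot_bilinear m).

Lemma l2dot_herm m (x y : l2 m) : l2dot x y = (-1) ^+ false * (l2dot y x)^*.
Proof.
rewrite mul1r /l2dot !mxE rmorph_sum; apply: eq_bigr => i _.
by rewrite !mxE rmorphM /= conjCK mulrC.
Qed.

HB.instance Definition _ m :=
  isHermitianSesquilinear.Build C (l2 m) false Num.conj (@l2dot m) (@l2dot_herm m).

Lemma l2dot_gt0 m (x : l2 m) : x != 0 -> 0 < l2dot x x.
Proof.
move=> x0; rewrite lt_def cv_sqnorm_ge0 andbT.
by apply: contra x0 => /eqP /cv_sqnorm_eq0 ->.
Qed.

HB.instance Definition _ m := isDotProduct.Build C (l2 m) (@l2dot m) (@l2dot_gt0 m).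

Definition l2form m : {dot (l2 m) for Num.conj} := @l2dot m.

Lemma l2_sqnorm m (x : l2 m) : `|x| ^+ 2 = l2dot x x.
Proof. by rewrite -[LHS]/(l2norm x ^+ 2) sqrtCK. Qed.

Lemma l2_coord m (x : l2 m) i : `|(x : 'cV[C]_m) i 0| <= `|x|.
Proof.
rewrite -ler_sqr ?nnegrE // l2_sqnorm /l2dot cv_sqnorm (bigD1 i) //= lerDl.
by rewrite sumr_ge0 // => j _; rewrite exprn_ge0.
Qed.

Lemma l2_norm_le m (x : l2 m) : `|x| <= \sum_i `|(x : 'cV[C]_m) i 0|.
Proof.
pose e i : l2 m := delta_mx i 0 : 'cV[C]_m.
have e1 i : `|e i| = 1.
  rewrite -[LHS]/(l2norm (e i)) /l2norm /l2dot cv_sqnorm (bigD1 i) //= !mxE !eqxx.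
  rewrite normr1 expr1n big1 ?addr0 ?sqrtC1 // => j /negbTE ji.
  by rewrite mxE ji normr0 expr0n.
have {1}-> : x = \sum_i (x : 'cV[C]_m) i 0 *: e i.
  rewrite [LHS](matrix_sum_delta (x : 'cV[C]_m)); apply: eq_bigr => i _.
  by rewrite big_ord1.
rewrite (le_trans (ler_norm_sum _ _ _)) // ler_sum // => i _.
by rewrite normrZ e1 mulr1.
Qed.

End HilbertSpace.

(** Completeness is brought back to that of the reals: the finitely many coordinates are
    1-Lipschitz, so they converge along a Cauchy filter, and together they control the norm. *)
Lemma complete_of_real_coordinates (R : realType) (V : normedModType R[i])
    (J : finType) (rho : J -> V -> R) :
  (forall j x y, `|rho j x - rho j y|%:C%C <= `|x - y|) ->
  (forall l : J -> R, exists v, forall x,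
     `|v - x| <= (\sum_j `|l j - rho j x|)%:C%C) ->
  forall F : set_system V, ProperFilter F -> cauchy F -> cvg F.
Proof.
move=> rho_le rho_surj F PF cF.
have lim_rho j : exists l : R, forall e, 0 < e -> F [set x | `|l - rho j x| < e].
  have PG : ProperFilter (rho j @ F) by exact: fmap_proper_filter.
  have : cauchy (rho j @ F).
    apply: cauchy_exP => e e0; have /cauchyP/(_ e%:C%C) := cF.
    rewrite ltcR => /(_ e0) [x Fx]; exists (rho j x).
    apply: (@filterS _ F _ (ball x e%:C%C)) => // y.
    move=> xy; have {}xy : `|x - y| < e%:C%C by move: xy; rewrite -ball_normE.
    by rewrite -ball_normE /= -ltcR (le_lt_trans _ xy).
  move=> /R_complete /cvg_ex [l Fl]; exists l => e e0.
  have /cvgrPdist_lt/(_ e e0) := Fl; exact.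
have /fin_all_exists [l lP] := lim_rho.
have [v vP] := rho_surj l; apply/cvg_ex; exists v.
apply/cvgrPdist_lt => e e0.
have eE : e = (complex.Re e)%:C%C.
  by case: e e0 => a b; rewrite ltcE /= => /andP[/eqP -> _].
(* The extra one makes the sum of the [r] over [J] strictly smaller than [e] and covers an empty
   [J]. *)
pose r := complex.Re e / #|J|.+1%:R.
have r0 : 0 < r.
  by rewrite divr_gt0 // -ltcR -eE.
have : \forall x \near F, forall j, `|l j - rho j x| < r.
  by apply: filter_forall => j; exact: lP.
apply: filterS => x /= xl; rewrite (le_lt_trans (vP x)) // eE ltcR.
rewrite (@le_lt_trans _ _ (\sum_(j : J) r)) //.
  by apply: ler_sum => j _; apply: ltW; exact: xl.
rewrite sumr_const -mulr_natr /r mulrAC ltr_pdivrMr // ltr_pM2l ?ltr_nat //.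
by rewrite -ltcR -eE.
Qed.

Lemma complex_norm_le (R : realType) (z : R[i]) :
  `|z| <= (`|complex.Re z| + `|complex.Im z|)%:C%C.
Proof.
rewrite normc_def lecR -[leRHS]ger0_norm ?addr_ge0 // -sqrtr_sqr.
rewrite ler_sqrt ?sqr_ge0 // sqrrD !real_normK ?num_real //.
by rewrite lerD2r lerDl mulrn_wge0 // mulr_ge0.
Qed.

Lemma complex_Im_le (R : realType) (z : R[i]) : `|complex.Im z|%:C%C <= `|z|.
Proof.
rewrite normc_def lecR -sqrtr_sqr ler_sqrt ?addr_ge0 ?sqr_ge0 //.
by rewrite lerDr sqr_ge0.
Qed.

Lemma l2_complete (R : realType) m (F : set_system (l2 R[i] m)) :
  ProperFilter F -> cauchy F -> cvg F.
Proof.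
pose rho (j : 'I_m * bool) (x : l2 R[i] m) : R :=
  let z := (x : 'cV[R[i]]_m) j.1 0 in if j.2 then complex.Re z else complex.Im z.
apply: (@complete_of_real_coordinates R _ _ rho) => [[i b] x y|l].
  have le := l2_coord (x - y) i; apply: le_trans le; rewrite /rho /=.
  rewrite [(_ - _ : 'cV__) i 0](_ : _ = (x : 'cV[R[i]]_m) i 0 - (y : 'cV[R[i]]_m) i 0).
    by case: b; rewrite -raddfB /= ?normc_ge_Re ?complex_Im_le.
  by rewrite !mxE.
exists (\col_i (l (i, true) +i* l (i, false))%C : 'cV[R[i]]_m) => x.
rewrite (le_trans (l2_norm_le _)) //.
rewrite (eq_bigr (fun p => `|l (p.1, p.2) - rho (p.1, p.2) x|)) => [|[i b] _] //.
rewrite -(pair_bigA _ (fun i b => `|l (i, b) - rho (i, b) x|)) /= rmorph_sum /=.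
apply: ler_sum => i _; rewrite (le_trans (complex_norm_le _)) //.
rewrite !mxE big_bool /rho /= lecR.
by case: ((x : 'cV[R[i]]_m) i 0).
Qed.

HB.instance Definition _ (R : realType) m :=
  Uniform_isComplete.Build (l2 R[i] m) (@l2_complete R m).

(** * Differentiability of rational functions and continuity of matrix operators *)

Section Analytic.
Context {C : numClosedFieldType}.

Lemma continuous_finsum (V W : normedModType C) (I : finType) (g : I -> V -> W) :
  (forall i, continuous (g i)) -> continuous (fun x => \sum_i g i x).
Proof.
move=> gc; have -> : (fun x => \sum_i g i x) = \sum_i g i.
  by apply/funext => x; rewrite fct_sumE.
elim/big_ind: _ => [|h k hc kc|i _] //; first by move=> x; exact: cst_continuous.
by move=> x; apply: continuousD; [exact: hc | exact: kc].
Qed.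

Lemma differentiable_mev d (p : mpoly d C) (z : 'rV[C]_d) : differentiable (mev p) z.
Proof.
move: p; apply: (@mpoly_ring_ind C d) => [c|i|p q dp dq|p q dp dq].
- rewrite (_ : mev _ = cst c); first exact: differentiable_cst.
  by apply/funext => x; rewrite /mev mevalC.
- rewrite (_ : mev _ = fun x : 'rV[C]_d => x 0 i); first exact: differentiable_coord.
  by apply/funext => x; rewrite /mev mevalXU.
- rewrite (_ : mev _ = mev p + mev q); first exact: differentiableD.
  by apply/funext => x; rewrite /mev mevalD.
- rewrite (_ : mev _ = mev p * mev q); first exact: differentiableM.
  by apply/funext => x; rewrite /mev mevalM.
Qed.

Lemma differentiable_quotient d n (s : mpoly d C) (Q : 'M[mpoly d C]_n)
    (z : 'rV[C]_d) : mev s z != 0 ->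
  differentiable (fun z : 'rV[C]_d =>
    (mev s z)^-1 *: map_mx (meval (fun k => z 0 k)) Q) z.
Proof.
move=> sz; rewrite (_ : (fun _ => _) = \sum_i \sum_j (fun z : 'rV[C]_d =>
    ((mev s z)^-1 * mev (Q i j) z) *: (delta_mx i j : 'M[C]_n))); last first.
  apply/funext => x; rewrite fct_sumE [LHS]matrix_sum_delta.
  apply: eq_bigr => i _; rewrite fct_sumE; apply: eq_bigr => j _.
  by rewrite !mxE.
apply: differentiable_sum => i; apply: differentiable_sum => j.
apply: differentiableZl; apply: differentiableM (differentiable_mev _ _).
exact: differentiableV (differentiable_mev _ _) sz.
Qed.

Lemma l2_coord_continuous m i : continuous (fun x : l2 C m => (x : 'cV[C]_m) i 0 : C).
Proof.
move=> x; apply/(@cvgrPdist_lt _ _ _ (nbhs x)) => e e0.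
apply: filterS (nbhsx_ballx x e e0) => y; rewrite -ball_normE /=.
by apply: le_lt_trans; have := l2_coord (x - y) i; rewrite !mxE.
Qed.

Definition mxop n m (M : 'M[C]_(n + m)) (x : 'cV[C]_n * l2 C m) :
    'cV[C]_n * l2 C m :=
  let y := M *m col_mx x.1 (x.2 : 'cV[C]_m) in (usubmx y, dsubmx y).

Lemma mxop_linear n m (M : 'M[C]_(n + m)) : linear (mxop M).
Proof.
move=> a x y; rewrite /mxop.
have -> : col_mx (a *: x + y).1 ((a *: x + y).2 : 'cV[C]_m) =
    a *: col_mx x.1 (x.2 : 'cV[C]_m) + col_mx y.1 (y.2 : 'cV[C]_m).
  by rewrite scale_col_mx add_col_mx.
by rewrite mulmxDr -scalemxAr !linearD !linearZ.
Qed.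

HB.instance Definition _ n m (M : 'M[C]_(n + m)) :=
  GRing.isLinear.Build C _ _ _ (mxop M) (mxop_linear M).

Lemma mxop_continuous n m (M : 'M[C]_(n + m)) : continuous (mxop M).
Proof.
rewrite (_ : mxop M = fun x =>
    (\sum_i x.1 i 0 *: mxop M (delta_mx i 0, 0)) +
    (\sum_i (x.2 : 'cV[C]_m) i 0 *: mxop M (0, delta_mx i 0 : 'cV[C]_m))); last first.
  apply/funext => x; under eq_bigr => i _ do rewrite -linearZ.
  under [X in _ = _ + X]eq_bigr => i _ do rewrite -linearZ.
  rewrite -!linear_sum -linearD /=; congr mxop.
  have fstS (I : finType) (F : I -> 'cV[C]_n * l2 C m) :
      (\sum_i F i).1 = \sum_i (F i).1 by exact: (big_morph fst).
  have sndS (I : finType) (F : I -> 'cV[C]_n * l2 C m) :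
      (\sum_i F i).2 = \sum_i (F i).2 by exact: (big_morph snd).
  have cvE p (v : 'cV[C]_p) : v = \sum_i v i 0 *: delta_mx i 0.
    rewrite [LHS]matrix_sum_delta; apply: eq_bigr => i _.
    by rewrite big_ord1.
  apply: injective_projections; rewrite /= !(fstS, sndS) /=.
    by rewrite [X in _ = _ + X]big1 ?addr0 => [|i _]; rewrite ?scaler0 // -cvE.
  by rewrite [X in _ = X + _]big1 ?add0r => [|i _]; rewrite ?scaler0 //; exact: cvE.
move=> x; apply: continuousD; apply: continuous_finsum => i y; apply: cvgZr_tmp.
  apply: (@continuous_comp _ _ _ fst (fun u : 'cV[C]_n => u i 0)).
    exact: cvg_fst.
  exact: coord_continuous.
apply: (@continuous_comp _ _ _ snd (fun u : l2 C m => (u : 'cV[C]_m) i 0)).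
  exact: cvg_snd.
exact: l2_coord_continuous.
Qed.

End Analytic.

Lemma mulmx_l2_continuous (C : numClosedFieldType) m (M : 'M[C]_m) :
  continuous ((fun x => M *m x : 'cV[C]_m) : l2 C m -> l2 C m).
Proof.
rewrite (_ : (fun _ => _) = fun x : l2 C m =>
    \sum_i (x : 'cV[C]_m) i 0 *: (col i M : l2 C m)); last first.
  apply/funext => x; apply/matrixP => i j; rewrite !mxE summxE (ord1 j).
  by apply: eq_bigr => l _; rewrite !mxE mulrC.
apply: continuous_finsum => i y; apply: cvgZr_tmp.
  exact: (nbhs_filter y).
exact: l2_coord_continuous.
Qed.

Lemma BHratclass_of_schur (R : realType) d n m (A : 'I_d -> 'M[R[i]]_(n + m))
    (f : 'rV[R[i]]_d -> 'M[R[i]]_n) :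
  (forall k, psdmx (A k)) ->
  (forall x : 'cV[R[i]]_m, (forall k, drsubmx (A k) *m x = 0) -> x = 0) ->
  (forall z, polyhalfplane z -> f z = schur (pencil A z)) ->
  exists2 g : 'rV[R[i]]_d -> 'M[R[i]]_n, BHratclass g &
     forall z, polyhalfplane z -> f z = g z.
Proof.
move=> Apsd Ank fA.
pose s := \det (drsubmx (mpencil id A)); pose S := schur_num (mpencil id A).
(* The Schur complement is written as a quotient of polynomials, from which differentiability and
   rationality on Omega are immediate. *)
pose g (z : 'rV[R[i]]_d) := (mev s z)^-1 *: map_mx (meval (fun k => z 0 k)) S.
have s0 z : Omega z -> mev s z != 0 by exact: mev_det22_neq0.
have gE z : Omega z -> g z = schur (pencil A z).
  by move=> zO; rewrite -mev_mpencil_id schur_map //; exact: s0.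
exists g => [|z zP]; last by rewrite fA // gE //; exact: polyhalfplane_Omega.
split; last exact: (rational_on_quotient s0).
split; first by move=> z /s0 sz; exact: differentiable_quotient.
exists (l2 R[i] m), (@l2form _ m), (fun k => mxop (A k) : {linear _ -> _}); split.
- exact: l2_sqnorm.
- by move=> k; exact: mxop_continuous.
- move=> k x; have := (Apsd k).2 (col_mx x.1 (x.2 : 'cV[R[i]]_m)).
  rewrite tr_col_mx map_row_mx -mulmxA -{1}[A k *m _]vsubmxK mul_row_col mxE.
  exact.
move=> z zO L; have uA := unit_pencil22 Apsd Ank zO.
have LE x : L x = mxop (pencil A z) x.
  have fstS (I : finType) (F : I -> 'cV[R[i]]_n * l2 R[i] m) :
      (\sum_i F i).1 = \sum_i (F i).1 by exact: (big_morph fst).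
  have sndS (I : finType) (F : I -> 'cV[R[i]]_n * l2 R[i] m) :
      (\sum_i F i).2 = \sum_i (F i).2 by exact: (big_morph snd).
  rewrite /L /oppencil /mxop /pencil mulmx_suml.
  apply: injective_projections; rewrite /= !(fstS, sndS) linear_sum /=.
    by apply: eq_bigr => k _; rewrite -scalemxAl linearZ.
  by apply: eq_bigr => k _; rewrite -scalemxAl linearZ.
have L11 u : op11 L u = ulsubmx (pencil A z) *m u.
  rewrite /op11 LE /mxop /= -{1}[pencil A z]submxK mul_block_col !mulmx0 !addr0.
  by rewrite col_mxKu.
have L21 u : op21 L u = dlsubmx (pencil A z) *m u.
  rewrite /op21 LE /mxop /= -{1}[pencil A z]submxK mul_block_col !mulmx0 !addr0.
  by rewrite col_mxKd.
have L12 y : op12 L y = ursubmx (pencil A z) *m y.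
  rewrite /op12 LE /mxop /= -{1}[pencil A z]submxK mul_block_col !mulmx0 !add0r.
  by rewrite col_mxKu.
have L22 y : op22 L y = drsubmx (pencil A z) *m y.
  rewrite /op22 LE /mxop /= -{1}[pencil A z]submxK mul_block_col !mulmx0 !add0r.
  by rewrite col_mxKd.
exists (fun x => invmx (drsubmx (pencil A z)) *m x : 'cV[R[i]]_m).
  split; first exact: mulmx_l2_continuous.
  - by move=> x; rewrite L22 mulKmx.
  - by move=> x; rewrite L22 mulKVmx.
by move=> u; rewrite gE // L11 L21 L12 /schur mulmxBl !mulmxA.
Qed.

(** * Equivalence of the five conditions *)

Theorem theorem3p1 (R : realType) (d n : nat) (d_gt0 : (0 < d)%N)
    (n_gt0 : (0 < n)%N) (f : 'rV[R[i]]_d -> 'M[R[i]]_n) :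
  [<->
   (* (0) *)
   exists2 r : 'M[ratfun R[i] d]_n, Bclass r & restriction (@polyhalfplane R[i] d) r f ;
   (* (1) *)
   exists2 g : 'rV[R[i]]_d -> 'M[R[i]]_n, BHratclass g &
     forall z, polyhalfplane z -> f z = g z ;
   (* (2) *)
   exists2 g : 'rV[R[i]]_d -> 'M[R[i]]_n,
     exists Phi : 'I_d -> 'rV[R[i]]_d -> 'rV[R[i]]_d -> 'M[R[i]]_n,
       [/\ forall k, sesquirational_on (@Omega R[i] d) (Phi k),
           forall k, positive_kernel (@Omega R[i] d) (Phi k),
           forall k w z (lam : R[i]), Omega w -> Omega z -> lam != 0 ->
             Phi k (lam *: w) (lam *: z) = Phi k w z
         & forall w z, Omega w -> Omega z ->
             g z = \sum_k z 0 k *: Phi k w z] &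
     forall z, polyhalfplane z -> f z = g z ;
   (* (2') *)
   exists2 g : 'rV[R[i]]_d -> 'M[R[i]]_n,
     exists (N : 'I_d -> nat)
            (phi : forall k, 'rV[R[i]]_d -> 'M[R[i]]_(N k, n)),
       [/\ forall k, rational_on (@Omega R[i] d) (phi k),
           forall k z (lam : R[i]), Omega z -> lam != 0 ->
             phi k (lam *: z) = phi k z
         & forall w z, Omega w -> Omega z ->
             g z = \sum_k z 0 k *: ((phi k w) ^t* *m phi k z)] &
     forall z, polyhalfplane z -> f z = g z ;
   (* (3) *)
   [/\ cayley_defined f,
       exists (m : 'I_d -> nat) (A : 'M[R[i]]_(\sum_k m k))
              (B : 'M[R[i]]_(\sum_k m k, n)) (E : 'M[R[i]]_(n, \sum_k m k))
              (D : 'M[R[i]]_n),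
         [/\ block_mx A B E D \is unitarymx,
             block_mx A B E D \is hermsymmx
           & GR_representation A B E D (double_cayley f)]
     & ~ spectrum (double_cayley f 0) 1] ].
Proof.
have PO := @polyhalfplane_Omega R[i] d.
(* The implications form a cycle in the order of the list, and each passes through [Schur_data] on
   Pi^d. *)
tfae.
- move=> [r rB rf]; have [m [A [Apsd Ank fA]]] := Schur_data_of_Bclass rB rf.
  exact: BHratclass_of_schur Apsd Ank fA.
- move=> [g [[_ repg] ratg] fg].
  have [Phi [Phi_pos gE]] := kernels_of_Hilbert_representation repg.
  have [|||m [A [Apsd Ank fA]]] := @Schur_data_of_kernels R[i] d n f Phi.
  + by move=> k N l u lP; apply: Phi_pos => i; exact: PO.
  + by move=> w z wP zP; rewrite fg // (gE w) //; exact: PO.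
  + move=> z0 z0P i j; have [p [q [q0 pq]]] := regular_at_of_rational PO ratg z0P i j.
    by exists p, q; split=> // z zP; rewrite fg // pq.
  (* The kernels obtained from the Hilbert space need not be rational; those of the
     finite-dimensional pencil are, and they replace them. *)
  exists (fun z => schur (pencil A z)); last exact: fA.
  exists (fun k w z => (schur_sol (pencil A w)) ^t* *m A k *m schur_sol (pencil A z)).
  split=> [k|k|k w z lam wO zO l0|w z wO zO].
  + exact: sesquirational_kernel.
  + exact: positive_kernel_gram.
  + by rewrite !schur_solZ.
  + exact: schur_sumE.
- move=> [g [Phi [Phi_rat Phi_pos _ gE]] fg].
  have [|||m [A [Apsd Ank fA]]] := @Schur_data_of_kernels R[i] d n f Phi.
  + by move=> k N l u lP; apply: Phi_pos => i; exact: PO.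
  + by move=> w z wP zP; rewrite fg // (gE w) //; exact: PO.
  (* With [w] frozen at the all-ones point, [f] is the sum of the [z_k Phi_k(w, z)], rational in
     [z]. *)
  + move=> z0 z0P i j; have wO := PO _ (const1_polyhalfplane (C := R[i]) (d := d)).
    have [||p [q [q0 pq]]] := @regular_at_sum R[i] d _ z0 (fun k z => z 0 k)
      (fun k z => Phi k (const_mx 1) z i j).
    * by move=> k; exists (mpolyX _ (mnm1 k)) => z; rewrite /mev mevalXU.
    * by move=> k; exact: (regular_at_of_sesquirational PO (Phi_rat k) wO z0P).
    exists p, q; split=> // z zP; rewrite -pq // fg // (gE _ _ wO); last exact: PO.
    by rewrite summxE; congr (_ * _); apply: eq_bigr => k _; rewrite mxE.
  exists (fun z => schur (pencil A z)); last exact: fA.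
  have /fin_all_exists [S SE] k := psdmx_factor (Apsd k).
  exists (fun=> (n + m)%N), (fun k z => S k *m schur_sol (pencil A z)).
  split=> [k|k z lam zO l0|w z wO zO].
  + exact: rational_schur_sol.
  + by rewrite schur_solZ.
  + rewrite (schur_sumE Apsd Ank wO zO); apply: eq_bigr => k _.
    by rewrite [in LHS]SE ctmxM !mulmxA.
- move=> [g [N [phi [_ _ gE]]] fg].
  have [|||m [A [Apsd Ank fA]]] := @Schur_data_of_sums R[i] d n N phi
    (@polyhalfplane R[i] d) f (const_mx 1).
  + exact: PO.
  + exact: const1_polyhalfplane.
  + by move=> w z wP zP; rewrite fg // (gE w) //; exact: PO.
  split; [exact: cayley_defined_of_schur Apsd Ank fA | | ].
    exact: GR_of_schur Apsd Ank fA.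
  exact: cayley_spectrum_of_schur Apsd Ank fA.
- move=> [fdef [mk [A [B [E [D [Uu Uh GR]]]]]] _].
  have [m [A' [Apsd Ank fA]]] := Schur_data_of_GR fdef Uu Uh GR.
  exact: Bclass_of_schur Apsd Ank fA.
Qed.
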